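(* Let $n\ge 2$ and $\vec k=(k_1,\dots,k_m)$ with $1\le k_i\le n-1$. For every untagged $\mathfrak{sl}_n$ web $G\in F(\vec{k})$, $f(G)\neq 0$; in particular, the monomial $x_{S_0}$ has nonzero coefficient in $f(G)$.
   Context: Webs. Fix $n\ge2$. An untagged $\mathfrak{sl}_n$ web is a finite directed plane graph embedded in the closed half-plane below a horizontal boundary axis, considered up to planar isotopy relative to the boundary, whose edges carry weights in $\{1,\dots,n-1\}$; boundary vertices are univalent and lie on the axis; all other (interior) vertices are trivalent; directed weighted closed loops without vertices are allowed as components. For a vertex $v$ and incident edge $e$ put $\sigma_v(e)=1$ if $e$ is directed into $v$ and $-1$ if out of $v$. At each interior vertex $v$ with incident edges $e_1,e_2,e_3$ of weights $\ell_1,\ell_2,\ell_3$ one requires $\sum_i\sigma_v(e_i)\ell_i\equiv 0 \pmod n$. If $v_1,\dots,v_m$ are the boundary vertices from left to right and $e_i$ is the edge at $v_i$, of weight $\ell_i$, the boundary weight vector is $\vec k=(k_1,\dots,k_m)$ with $k_i=\ell_i$ if $\sigma_{v_i}(e_i)=1$ and $k_i=n-\ell_i$ if $\sigma_{v_i}(e_i)=-1$. $F(\vec k)$ is the set of webs with boundary weight vector $\vec k$. Strandings. A stranding $S$ of $G$ is a collection of directed paths in $G$ (simple strands), each with a color in $\{1,\dots,n-1\}$, each either closed or with both endpoints on the boundary, paths of the same color being pairwise disjoint. For an edge $e$, $S_+(e)$ (resp. $S_-(e)$) is the set of colors of strands running along $e$ with (resp. against) its direction, $S(e)=S_+(e)\sqcup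 S_-(e)$, and $\alpha_c^\vee(e)=1,-1,0$ according to $c\in S_+(e)$, $c\in S_-(e)$, $c\notin S(e)$. $S$ is valid if for every edge $e$ of weight $\ell$: (1) the nonzero values $\alpha_c^\vee(e)$ alternate in sign as $c$ increases; (2) with $c_{\max}$ the largest color in $S(e)$, $\sum_{c=1}^{n-1}\alpha_c^\vee(e)c$ equals $\ell$ if $c_{\max}\in S_+(e)$ and $\ell-n$ if $c_{\max}\in S_-(e)$ (in particular $S(e)\neq\emptyset$). $\mathcal{S}tr(G)$ is the set of valid strandings. $(i,j)$-strands. For $1\le i<j\le n$ the sum $\sum_{c=i}^{j-1}\alpha_c^\vee(e)$ lies in $\{-1,0,1\}$. The $(i,j)$-strands of $S$ are the connected components of the directed graph consisting of the edges $e$ for which this sum is nonzero, directed as $e$ if the sum is $1$ and oppositely to $e$ if it is $-1$; each is a directed closed curve or a directed path with endpoints on the boundary. An open strand is clockwise if it runs from its right endpoint to its left endpoint and counterclockwise otherwise. $x(S)$ is the total number, over all $i<j$, of closed clockwise $(i,j)$-strands; $y(S)$ is the total number, over all $i<j$, of counterclockwise $(i,j)$-strands, both closed and open. Binary labels, monomials, web vector. For $S\in\mathcal{S}tr(G)$ and an edge $e$, $b_S(e)\in\{0,1\}^n$ is defined by $b_S(e)_n=0$ if $\alpha^\vee_{c_{\max}}(e)=1$, $b_S(e)_n=1$ if $\alpha^\vee_{c_{\max}}(e)=-1$, and $b_S(e)_c-b_S(e)_{c+1}=\alpha_c^\vee(e)$ for $1\le c\le n-1$. For the boundary edge $e_j$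 let $\hat b(e_j)=b_S(e_j)$ if $\sigma_{v_j}(e_j)=1$ and $\hat b(e_j)=\vec 1-b_S(e_j)$ if $\sigma_{v_j}(e_j)=-1$, where $\vec 1=(1,\dots,1)$. Let $V_k$ be the $\mathbb C(q)$-vector space $\bigwedge_q^k\mathbb C_q^n$ with basis $x_{\vec b}$ indexed by $\vec b\in\{0,1\}^n$ with exactly $k$ ones, and $V(\vec k)=V_{k_1}\otimes\cdots\otimes V_{k_m}$. Put $x_S=x_{\hat b(e_1)}\otimes\cdots\otimes x_{\hat b(e_m)}\in V(\vec k)$ and $f(G)=\sum_{S\in\mathcal{S}tr(G)}(-q)^{x(S)-y(S)}x_S$. The monomial $x_{S_0}$. Let $c_j\in\{0,\dots,n-1\}$ be the residue of $\sum_{t=1}^jk_t$ modulo $n$ (so $c_0=0$), let $\vec\lambda_i\in\{0,1\}^n$ have $1$ in the first $i$ positions and $0$ elsewhere ($\vec\lambda_0=\vec 0$), and let $\vec b_j=\vec\lambda_{c_j}-\vec\lambda_{c_{j-1}}$ if $c_{j-1}<c_j$ and $\vec b_j=\vec1+\vec\lambda_{c_j}-\vec\lambda_{c_{j-1}}$ if $c_j<c_{j-1}$. Then $x_{S_0}=x_{\vec b_1}\otimes\cdots\otimes x_{\vec b_m}$. *)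

(* Defs.v *)
From HB Require Import structures.
From mathcomp Require Import all_boot all_order all_algebra.
From mathcomp Require Import complex.
From mathcomp Require Import boolp reals.
From mathcomp Require Import zify.

Set Implicit Arguments.
Unset Strict Implicit.
Unset Printing Implicit Defensive.

Import Order.TTheory GRing.Theory Num.Theory.
Local Open Scope ring_scope.

(* Colors 1, ..., n-1 are the nonzero elements of 'I_n.  The positions        *)
(* 1, ..., n of a binary label are represented by 0, ..., n-1 : 'I_n.         *)

Section Curves.
Variable R : realType.
Notation point := (R * R)%type.
Implicit Types (s : seq point) (x : point).

(* A polygonal curve is the list of its successive corners.  Its points are   *)
(* parametrized by (i, t): the point at time t of the i-th segment.           *)
Definition curve_pt s (i : nat) (t : R) : point :=
  let a := nth (0, 0) s i in let b := nth (0, 0) s i.+1 in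
  ((1 - t) * a.1 + t * b.1, (1 - t) * a.2 + t * b.2).

Definition on_curve s x : Prop :=
  exists i t, [/\ (i.+1 < size s)%N, 0 <= t <= 1 & x = curve_pt s i t].

(* Injectivity of the parametrization, the final point of the curve excepted. *)
Definition simple_curve s : Prop :=
  forall i t i' t', (i.+1 < size s)%N -> (i'.+1 < size s)%N ->
    0 <= t < 1 -> 0 <= t' < 1 ->
    curve_pt s i t = curve_pt s i' t' -> i = i' /\ t = t'.

Definition first_pt s : point := head (0, 0) s.
Definition last_pt s : point := last (0, 0) s.

Definition simple_closed_curve s : Prop :=
  [/\ (1 < size s)%N, simple_curve s & last_pt s = first_pt s].

Definition simple_arc s : Prop :=
  [/\ (1 < size s)%N, simple_curve s &
      forall i t, (i.+1 < size s)%N -> 0 <= t < 1 ->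
        curve_pt s i t <> last_pt s].

(* Twice the integral of (x dy - y dx) / 2 along the curve; by Green's        *)
(* formula, for a simple closed curve this is twice the enclosed area, with   *)
(* sign + if the curve runs counterclockwise and - if it runs clockwise.      *)
Definition area2 s : R :=
  \sum_(i < (size s).-1)
    ((nth (0, 0) s i).1 * (nth (0, 0) s i.+1).2
     - (nth (0, 0) s i).2 * (nth (0, 0) s i.+1).1).

End Curves.

(* Planar isotopy classes of webs are given by polygonal representatives.     *)
(* The boundary axis is {y = 0}.  The boundary vertices are indexed by 'I_m;  *)
(* [ends e] is the pair (source, target) of the edge e, or None when e is a   *)
(* closed loop without vertices.  A dart (e, b) is the edge e traversed along *)
(* its direction if b = true, against it if b = false; the edge-ends at a     *)
(* vertex v are thus the darts with head v, and sigma_v(e) = sgn b.           *)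

Definition sgn (A : pzRingType) (b : bool) : A := if b then 1 else -1.
Arguments sgn {A} b.

Section DartEnds.
Variables (V E : Type) (ends : E -> option (V * V)).

Definition head_of (d : E * bool) : option V :=
  omap (fun uv => if d.2 then uv.2 else uv.1) (ends d.1).

Definition tail_of (d : E * bool) : option V := head_of (d.1, ~~ d.2).

End DartEnds.

Record web (R : realType) (n m : nat) := Web {
  ivert : finType;
  edge : finType;
  ends : edge -> option (('I_m + ivert) * ('I_m + ivert));
  wt : edge -> nat;
  bdart : 'I_m -> edge * bool;
  pos : 'I_m + ivert -> R * R;
  curve : edge -> seq (R * R);

  wt_range : forall e, (0 < wt e < n)%N;
  univalent : forall j d, (head_of ends d == Some (inl j)) = (d == bdart j);
  trivalent : forall v, #|[set d | head_of ends d == Some (inr v)]| = 3;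
  wt_balance : forall v,
    (n%:Z %| \sum_(d : edge * bool | head_of ends d == Some (inr v))
                sgn d.2 * (wt d.1)%:Z)%Z;

  pos_inj : injective pos;
  pos_axis : forall j, (pos (inl j)).2 = 0;
  pos_lr : forall j j' : 'I_m, (j < j')%N -> (pos (inl j)).1 < (pos (inl j')).1;
  curve_half_plane : forall e x, x \in curve e -> x.2 <= 0;
  curve_ends : forall e,
    match ends e with
    | Some (u, v) => [/\ simple_arc (curve e), first_pt (curve e) = pos u
                        & last_pt (curve e) = pos v]
    | None => simple_closed_curve (curve e)
    end;
  curve_disjoint : forall e e' x, e != e' ->
    on_curve (curve e) x -> on_curve (curve e') x ->
    (exists b v, head_of ends (e, b) = Some v /\ x = pos v) /\
    (exists b v, head_of ends (e', b) = Some v /\ x = pos v)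
}.

Section Web.
Variables (R : realType) (n m : nat) (G : web R n m).

Definition vert : finType := ('I_m + ivert G)%type.
Definition dart : finType := (edge G * bool)%type.

Definition dhead (d : dart) : option vert := head_of (@ends _ _ _ G) d.
Definition dtail (d : dart) : option vert := tail_of (@ends _ _ _ G) d.

Definition bweight (j : 'I_m) : nat :=
  let d := bdart G j in if d.2 then wt d.1 else (n - wt d.1)%N.

End Web.

Record webF (R : realType) (n m : nat) (k : 'I_m -> nat) := WebF {
  webF_web :> web R n m;
  webF_bweight : forall j, bweight webF_web j = k j
}.

(* [a c] stands for alpha_c(e), so that S(e) is the support of [a].           *)

Section EdgeLabel.
Variable n : nat.
Implicit Types (a : 'I_n -> int) (l : nat).

Definition alternating a : bool :=
  [forall c : 'I_n, forall c' : 'I_n,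
    [&& (c < c')%N, a c != 0, a c' != 0 &
        [forall d : 'I_n, (c < d < c')%N ==> (a d == 0)]]
    ==> (a c' == - a c)].

Definition is_cmax a (c : 'I_n) : bool :=
  (a c != 0) && [forall d : 'I_n, (a d != 0) ==> (d <= c)%N].

Definition valid_edge l a : bool :=
  alternating a &&
  [exists c : 'I_n, is_cmax a c &&
    (\sum_(d : 'I_n) a d * (d : nat)%:Z
       == if a c == 1 then l%:Z else l%:Z - n%:Z)].

(* The label b determined by b_n = 0 or 1 according to the sign at c_max, and *)
(* b_c - b_{c+1} = a c, i.e. b_c = b_n + \sum_(c <= d < n) a d.               *)
Definition label_last a : bool := [exists c, is_cmax a c && (a c == -1)].
Definition label_val a (i : nat) : int :=
  (label_last a)%:Z + \sum_(d : 'I_n | (i < d)%N) a d.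
Definition label a : {ffun 'I_n -> bool} := [ffun i : 'I_n => label_val a i == 1].

Definition compl_label (b : {ffun 'I_n -> bool}) : {ffun 'I_n -> bool} :=
  [ffun i => ~~ b i].

Definition ones (b : {ffun 'I_n -> bool}) : nat := #|[set i | b i]|.

Lemma ones_compl b : ones (compl_label b) = (n - ones b)%N.
Proof.
have -> : ones (compl_label b) = #|~: [set i | b i]|.
  by apply: eq_card => i; rewrite !inE ffunE.
by rewrite -[in RHS](card_ord n) -(cardsC [set i | b i]) addKn.
Qed.

Lemma onesE (v : 'I_n -> int) : (forall i, (v i == 0) || (v i == 1)) ->
  (ones [ffun i => v i == 1])%:Z = \sum_i v i.
Proof.
move=> hv; rewrite /ones -sum1_card -natz natr_sum big_mkcond /=.
apply: eq_bigr => i _; rewrite inE ffunE.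
by case/orP: (hv i) => /eqP ->.
Qed.

Section Valid.
Variables (l : nat) (a : 'I_n -> int).
Hypothesis (a_range : forall c, (a c == 0) || (`|a c| == 1)).
Hypothesis (a_valid : valid_edge l a).

Lemma label_val_range (i : nat) : (label_val a i == 0) || (label_val a i == 1).
Proof.
case/andP: a_valid => a_alt /existsP[cm /andP[cmP _]].
have [am0 ammax] := andP cmP.
have cm_uniq c : is_cmax a c -> c = cm.
  case/andP=> ac0 /forallP/(_ cm); rewrite am0 /= => le1.
  move/forallP/(_ c): ammax; rewrite ac0 /= => le2.
  by apply/val_inj/eqP; rewrite eqn_leq le2 le1.
have lastE : label_last a = (a cm == -1).
  apply/existsP/idP => [[c /andP[/cm_uniq -> //]]|h].
  by exists cm; rewrite cmP.
pose T j := \sum_(d : 'I_n | (j <= d)%N) a d.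
have key j : ((forall d : 'I_n, (j <= d)%N -> a d = 0) /\ T j = 0) \/
  exists c : 'I_n, [/\ (j <= c)%N, a c != 0,
    forall d : 'I_n, (j <= d < c)%N -> a d = 0 & T j *+ 2 = a c + a cm].
  have [p Ep] : exists p, (n - j)%N = p by eexists.
  elim: p j Ep => [|p IHp] j Ep.
    left; split=> [d jd|]; first by have := ltn_ord d; lia.
    by apply: big1 => d jd; have := ltn_ord d; lia.
  have jn : (j < n)%N by lia.
  pose oj := Ordinal jn.
  have TS : T j = a oj + T j.+1.
    rewrite /T (bigD1 oj) //=; congr (_ + _); apply: eq_bigl => d.
    by rewrite -(inj_eq val_inj) /=; lia.
  have noj (d : 'I_n) : (j <= d)%N -> d != oj -> (j < d)%N.
    by rewrite -(inj_eq val_inj) /=; lia.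
  have {}IHp := IHp j.+1 ltac:(lia).
  have [aj0|aj0] := eqVneq (a oj) 0.
    case: IHp => [[h0 T0]|[c [jc ac0 h0 T2]]]; [left | right].
      split=> [d jd|]; last by rewrite TS aj0 T0.
      by have [->//|/(noj _ jd)/h0] := eqVneq d oj.
    exists c; split=> //; first exact: ltnW.
      move=> d /andP[jd dc]; have [->//|/(noj _ jd) jd'] := eqVneq d oj.
      by apply: h0; rewrite jd'.
    by rewrite TS aj0 add0r.
  right; exists oj; split=> // [d /=|]; first lia.
  case: IHp => [[h0 T0]|[c [jc ac0 h0 T2]]].
    suff -> : cm = oj by rewrite TS T0 addr0 mulr2n.
    apply/esym/cm_uniq; rewrite /is_cmax aj0; apply/forallP => d.
    apply/implyP; apply: contraNT; rewrite -ltnNge => jd.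
    by apply/eqP/h0.
  have ajc : a c = - a oj.
    move/forallP/(_ oj)/forallP/(_ c): a_alt; rewrite jc aj0 ac0 /=.
    move/implyP=> h; apply/eqP/h/forallP => d; apply/implyP => hd.
    by apply/eqP/h0.
  by rewrite TS mulrnDl T2 ajc mulr2n; lia.
have {}key := key i.+1.
rewrite /label_val lastE -/(T i.+1).
have := a_range cm; case: key => [[_ ->]|[c [_ ac0 _]]].
  by case: (a cm == -1).
have := a_range c; rewrite (negPf ac0) (negPf am0) /= mulr2n.
move: (T _) (a c) (a cm) => t x y hx hy ht.
by have [hy1|hy1] := eqVneq y (-1); lia.
Qed.

Lemma label_valE (i : 'I_n) : ((label a i)%:Z : int) = label_val a i.
Proof. by rewrite ffunE; case/orP: (label_val_range i) => /eqP ->. Qed.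

Lemma label_last_pos (i : 'I_n) : i.+1 = n -> label a i = label_last a.
Proof.
move=> iE; rewrite ffunE /label_val big1 ?addr0; first by case: label_last.
by move=> d; have := ltn_ord d; lia.
Qed.

Lemma label_rec (i c : 'I_n) : i.+1 = c :> nat ->
  (label a i)%:Z - (label a c)%:Z = a c.
Proof.
move=> ic; rewrite !label_valE /label_val (bigD1 c) /=; last by rewrite -ic.
rewrite (eq_bigl (fun d : 'I_n => (c < d)%N)); last first.
  by move=> d; rewrite -(inj_eq val_inj) /=; lia.
by rewrite opprD addrACA subrr add0r addrK.
Qed.

Lemma ones_label : ones (label a) = l.
Proof.
case/andP: a_valid => _ /existsP[cm /andP[cmP /eqP sumE]].
have lastE : label_last a = (a cm == -1).
  apply/existsP/idP => [[c /andP[/andP[ac0 /forallP/(_ cm)]]]|h]; last first.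
    by exists cm; rewrite cmP.
  have [am0 /forallP/(_ c)] := andP cmP.
  rewrite am0 ac0 /= => h1 h2; suff -> : c = cm by [].
  by apply/val_inj/eqP; rewrite eqn_leq h1 h2.
have : (ones (label a))%:Z = l%:Z; last by case.
rewrite (onesE (v := fun i : 'I_n => label_val a i)); last first.
  by move=> i; exact: label_val_range.
rewrite big_split /= sumr_const card_ord.
rewrite (exchange_big_dep predT) //=.
have -> : \sum_(d : 'I_n) \sum_(i : 'I_n | (i < d)%N) a d =
          \sum_(d : 'I_n) a d * (d : nat)%:Z.
  apply: eq_bigr => d _; rewrite -natz mulr_natr sumr_const; congr (_ *+ _).
  have dn : (d <= n)%N by exact: ltnW.
  rewrite -sum1_card (big_ord_narrow dn) /= sum1_card card_ord //.
rewrite sumE lastE.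
have acm := a_range cm; have [am0 _] := andP cmP.
rewrite (negPf am0) /= in acm.
case: eqP => [h1|h1] /=; first by rewrite h1 /= -[_ *+ n]/(n%:R) natz; lia.
have -> : a cm == 1 by lia.
by rewrite mul0rn add0r.
Qed.

End Valid.
End EdgeLabel.

Section Strandings.
Variables (R : realType) (n m : nat) (G : web R n m).
Notation dart := (dart G).
Implicit Types (d : dart) (p : seq dart) (D C : {set dart}) (v : vert G).

Definition consecutive d d' : bool := dhead d == dtail d'.

(* A vertexless loop has head and tail None; as heads are pairwise distinct,  *)
(* it can only occur as a closed path by itself.                              *)
Definition closed_path p : bool :=
  [&& p != [::], cycle consecutive p, uniq [seq dhead d | d <- p] &
      uniq [seq d.1 | d <- p]].

Definition on_boundary (o : option (vert G)) : bool :=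
  if o is Some (inl _) then true else false.

Definition open_path p : bool :=
  if p is d :: p' then
    [&& path consecutive d p', on_boundary (dtail d),
        on_boundary (dhead (last d p')),
        uniq (dtail d :: [seq dhead d' | d' <- p]) &
        uniq [seq d'.1 | d' <- p]]
  else false.

(* A directed path is identified with the set of darts that it traverses.     *)
Definition simple_strand D : Prop :=
  exists2 p, D = [set d in p] & closed_path p \/ open_path p.

Definition touches d v : bool := (dhead d == Some v) || (dtail d == Some v).

Definition disjoint_strands D D' : Prop :=
  (forall d d', d \in D -> d' \in D' -> d.1 != d'.1) /\
  (forall d d' v, d \in D -> d' \in D' -> touches d v -> ~~ touches d' v).

Definition stranding (S : {set 'I_n * {set dart}}) : Prop :=
  (forall s, s \in S -> (0 < s.1)%N /\ simple_strand s.2) /\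
  (forall s s', s \in S -> s' \in S -> s != s' -> s.1 = s'.1 ->
     disjoint_strands s.2 s'.2).

(* The colors of the strands through the dart d; for an edge e, S_+(e) is     *)
(* [colors S (e, true)] and S_-(e) is [colors S (e, false)].                  *)
Definition colors (S : {set 'I_n * {set dart}}) d : {set 'I_n} :=
  [set c | [exists s in S, (s.1 == c) && (d \in s.2)]].

Definition alpha S (e : edge G) (c : 'I_n) : int :=
  if c \in colors S (e, true) then 1
  else if c \in colors S (e, false) then -1 else 0.

Definition valid_stranding (S : {set 'I_n * {set dart}}) : bool :=
  `[< stranding S >] && [forall e, valid_edge (wt e) (alpha S e)].

Definition Str : finType := {S : {set 'I_n * {set dart}} | valid_stranding S}.

Lemma alpha_range S e c : (alpha S e c == 0) || (`|alpha S e c| == 1).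
Proof. by rewrite /alpha; case: ifP => // _; case: ifP. Qed.

Lemma Str_valid (S : Str) e : valid_edge (wt e) (alpha (val S) e).
Proof. by have /andP[_ /forallP] := valP S. Qed.

Section IJ.
Variables (S : {set 'I_n * {set dart}}) (i j : nat).

Definition ij_sum (e : edge G) : int :=
  \sum_(c : 'I_n | (i <= c < j)%N) alpha S e c.

Definition ij_graph : {set dart} := [set d | ij_sum d.1 == sgn d.2].

Definition ij_adj d d' : bool :=
  [&& d \in ij_graph, d' \in ij_graph &
      [exists v, touches d v && touches d' v]].

Definition ij_strands : {set {set dart}} :=
  [set [set d' in ij_graph | connect ij_adj d d'] | d in ij_graph].

End IJ.

Definition closed_strand C : bool :=
  [forall d in C, ~~ on_boundary (dhead d) && ~~ on_boundary (dtail d)].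

Definition strand_area2 C : R := \sum_(d in C) sgn d.2 * area2 (curve d.1).

Definition closed_cw C : bool := closed_strand C && (strand_area2 C < 0).
Definition closed_ccw C : bool := closed_strand C && (0 < strand_area2 C).

(* Open and running from its left endpoint to its right endpoint. *)
Definition open_ccw C : bool :=
  [exists a : 'I_m, exists b : 'I_m,
    [&& (a < b)%N, [exists d in C, dtail d == Some (inl a)] &
        [exists d in C, dhead d == Some (inl b)]]].

Definition xnum S : nat :=
  \sum_(i < n.+1) \sum_(j < n.+1 | (0 < i < j)%N)
    #|[set C in ij_strands S i j | closed_cw C]|.

Definition ynum S : nat :=
  \sum_(i < n.+1) \sum_(j < n.+1 | (0 < i < j)%N)
    #|[set C in ij_strands S i j | closed_ccw C || open_ccw C]|.

Definition bdry_label S (j : 'I_m) : {ffun 'I_n -> bool} :=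
  let d := bdart G j in
  let b := label (alpha S d.1) in if d.2 then b else compl_label b.

Lemma ones_bdry_label (S : Str) j : ones (bdry_label (val S) j) = bweight G j.
Proof.
rewrite /bdry_label /bweight.
have H e := ones_label (@alpha_range (val S) e) (Str_valid S e).
by case: ifP => _; rewrite ?ones_compl H.
Qed.

End Strandings.

Notation Cq R := {fraction {poly R[i]}}.
Definition qvar (R : realType) : Cq R := tofrac 'X.

Section Tensor.
Variables (R : realType) (n : nat).

Definition blabel (k : nat) : finType :=
  {b : {ffun 'I_n -> bool} | ones b == k}.

Definition Vext (k : nat) := {ffun blabel k -> (Cq R)^o}.
Definition x_ k (b : blabel k) : Vext k := [ffun b' => (b' == b)%:R].

Variables (m : nat) (k : 'I_m -> nat).

Definition blabels : finType := {dffun forall j : 'I_m, blabel (k j)}.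

(* The tensor product of the V_(k_j), free on the products of basis elements; *)
(* [coef b v] is the coefficient of v on the tensor product of the x_(b j).   *)
Definition V := {ffun blabels -> (Cq R)^o}.
Definition tensor (v : forall j, Vext (k j)) : V :=
  [ffun b : blabels => \prod_j v j (b j)].
Definition coef (b : forall j, blabel (k j)) (v : V) : Cq R :=
  v [ffun j => b j].

Lemma coef_tensor b b' :
  coef b (tensor (fun j => x_ (b' j))) = [forall j, b j == b' j]%:R.
Proof.
rewrite /coef ffunE; case: forallP => [h|/forallP].
  by apply: big1 => j _; rewrite !ffunE h.
rewrite negb_forall => /existsP[j hj].
by rewrite (bigD1 j) //= !ffunE (negPf hj) mul0r.
Qed.

Lemma V_basis (v : V) :
  v = \sum_(b : blabels) coef b v *: tensor (fun j => x_ (b j)).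
Proof.
apply/ffunP => b; rewrite sum_ffunE (bigD1 b) //= big1 => [|b' b'b].
  rewrite addr0 !ffunE big1 => [|j _]; last by rewrite ffunE eqxx.
  rewrite /coef; suff -> : [ffun j => b j] = b by rewrite [RHS]mulr1.
  by apply/ffunP => j; rewrite ffunE.
rewrite !ffunE; suff -> : \prod_j x_ (b' j) (b j) = 0 by rewrite [LHS]mulr0.
have /existsP[j bj] : [exists j, b j != b' j].
  rewrite -negb_forall; apply: contra b'b => /forallP h.
  by apply/eqP/ffunP => j; apply/esym/eqP.
by rewrite (bigD1 j) //= ffunE (negPf bj) mul0r.
Qed.

End Tensor.

Section WebVector.
Variables (R : realType) (n m : nat) (k : 'I_m -> nat) (G : webF R n k).

Lemma ones_hat (S : Str G) j : ones (bdry_label (val S) j) == k j.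
Proof. by rewrite ones_bdry_label webF_bweight. Qed.

Definition hat_label (S : Str G) j : blabel n (k j) :=
  exist _ (bdry_label (val S) j) (ones_hat S j).

Definition xS (S : Str G) : V R n k := tensor (fun j => x_ R (hat_label S j)).

Definition web_vector : V R n k :=
  \sum_(S : Str G)
    (- qvar R) ^ ((xnum (val S))%:Z - (ynum (val S))%:Z) *: xS S.

End WebVector.

Section BaseMonomial.
Variables (n m : nat) (k : 'I_m -> nat).

Definition partial_residue (j : nat) : nat :=
  ((\sum_(t : 'I_m | (t < j)%N) k t) %% n)%N.

Definition lambda (i : nat) (p : 'I_n) : int := (p < i)%N%:Z.

Definition base_val (j : 'I_m) (p : 'I_n) : int :=
  let c' := partial_residue j in let c := partial_residue j.+1 in
  if (c' < c)%N then lambda c p - lambda c' p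
  else 1 + lambda c p - lambda c' p.

Hypothesis k_range : forall j, (0 < k j < n)%N.

Lemma ones_base j : ones [ffun p => base_val j p == 1] == k j.
Proof.
have /andP[k0 kn] := k_range j.
set c' := partial_residue j; set c := partial_residue j.+1.
have cE : c = ((c' + k j) %% n)%N.
  rewrite /c /c' /partial_residue modnDml (bigD1 j) //= addnC.
  congr ((_ + _) %% _)%N; apply: eq_bigl => t.
  by rewrite -(inj_eq val_inj) /=; lia.
have c'n : (c' < n)%N by rewrite ltn_mod; lia.
have cn : (c < n)%N by rewrite ltn_mod; lia.
have cV : c = (c' + k j)%N \/ (c + n = c' + k j)%N.
  have [lt|ge] := ltnP (c' + k j) n; first by left; rewrite cE modn_small.
  right; rewrite cE -(subnK ge) modnDr modn_small; lia.
have sum_lambda i : (i <= n)%N -> \sum_(p : 'I_n) lambda i p = i%:Z.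
  move=> hi; rewrite (eq_bigr (fun p : 'I_n => if (p < i)%N then 1%:R else 0)).
    rewrite -big_mkcond /= (big_ord_narrow hi (F := fun=> 1%:R)) sumr_const.
    by rewrite card_ord -[_ *+ _]/(i%:R) natz.
  by move=> p _; rewrite /lambda; case: ltnP.
rewrite -eqz_nat; apply/eqP; rewrite onesE => [|p]; rewrite /base_val -/c -/c'.
  have [cc'|cc'] := ltnP c' c.
    by rewrite sumrB !sum_lambda 1?ltnW //; lia.
  rewrite sumrB big_split /= !sum_lambda 1?ltnW // sumr_const card_ord.
  by rewrite -[_ *+ n]/(n%:R) natz; lia.
by rewrite /lambda; case: ifP => h; case: (ltnP p c); case: (ltnP p c'); lia.
Qed.

Definition base_label (j : 'I_m) : blabel n (k j) :=
  exist _ [ffun p => base_val j p == 1] (ones_base j).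

End BaseMonomial.

(* Main.v *)
(* The coefficient of x_{S_0} is a sum of integral powers of -q, one for each *)
(* stranding with the boundary labels of S_0; at q = -1 it counts these       *)
(* strandings, so it is enough to construct one of them.                      *)
(*                                                                            *)
(* Label the faces of the web by residues mod n, starting from 0 on the left, *)
(* in such a way that crossing an edge of weight l changes the label by l.    *)
(* The strands of color c are the oriented boundaries of the faces labelled   *)
(* c: the corresponding flow is conserved at every interior vertex, where at  *)
(* most one edge carries it in and at most one carries it out.                *)
(*                                                                            *)
(* The face labels exist by planarity.  After a shear no segment of the web   *)
(* is vertical; the label just below a segment s is the total weight of the   *)
(* segments that lie below s over a given abscissa.  It does not depend on    *)
(* the abscissa since the weights are conserved mod n in the region below s.  *)
Require Import Defs.
From HB Require Import structures.
From mathcomp Require Import all_boot all_order all_algebra.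
From mathcomp Require Import complex.
From mathcomp Require Import boolp reals.
From mathcomp Require Import zify ring lra.

Set Implicit Arguments.
Unset Strict Implicit.
Unset Printing Implicit Defensive.

Import Order.TTheory GRing.Theory Num.Theory.
Local Open Scope ring_scope.

(** * Non-crossing segments in the plane *)

(** Cancellation is impossible in the coefficient of $x_{S_0}$: it is a sum of powers of $-q$, each
    equal to 1 at $q=-1$ ([sum_Npow_qvar_neq0]), so one stranding with the boundary labels of $S_0$
    suffices ([exists_base_stranding]).

    It is read off the labels [L e] and [F e] of the faces to the left and right of each edge
    ([web_faces]). For every function f on residues, the signed sum of f(F) - f(L) around an
    interior vertex vanishes, because the faces there follow each other cyclically; around a
    boundary vertex it compares the partial sums of the weights up to and before that vertex. With f
    the indicator of a color this is a conserved flow with values in {-1, 0, 1}. Three such values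
    with sum zero contain at most one 1 and at most one -1, so by trivalence the flow is a disjoint
    union of simple strands ([flow_stranding]). Color 0 being discarded, an edge carries color F
    along and color L against its direction: the signs alternate, and the signed color sum F - L is
    the weight or the weight minus n ([face_flow_valid]). The label is a difference of
    $\vec\lambda$'s, up to $\vec 1$ ([label_face_flow]), which at the boundary is $\vec b_j$.

    The faces themselves are never constructed. Each segment gets the values [below] and [above];
    [vertex_law] and [top_law] compare the fans of segments to the left and right of a point, and in
    a fan sorted by slope the differences telescope. *)

Lemma telescope_by_key (R : realDomainType) (A : zmodType) (S : finType)
    (key : S -> R) (u : S -> A) (f : A -> int) (a : A) (K : {set S}) :
  {in K &, injective key} ->
  \sum_(s in K) (f (a + \sum_(s' in K | key s' < key s) u s' + u s)
                 - f (a + \sum_(s' in K | key s' < key s) u s'))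
  = f (a + \sum_(s in K) u s) - f a.
Proof.
have [p] := ubnP #|K|; elim: p K => // p IHp K leK injK.
have [->|[s0 s0K]] := set_0Vmem K; first by rewrite !big_set0 addr0 subrr.
(* The element of largest key enters no other partial sum, so it can be peeled off. *)
have [m mK maxm] := arg_maxP (P := fun s => s \in K) key s0K.
have lem s : s \in K :\ m -> key s < key m.
  rewrite !inE => /andP[sm sK]; rewrite lt_neqAle; have /= -> := maxm s sK.
  rewrite andbT.
  by apply: contra sm => /eqP /(injK _ _ sK mK) ->.
have below_m : \sum_(s' in K | key s' < key m) u s' = \sum_(s' in K :\ m) u s'.
  apply: eq_bigl => s; rewrite !inE; case: (eqVneq s m) => [->|sm] /=.
    by rewrite ltxx andbF.
  have [sK|//] := boolP (s \in K); apply: lem; by rewrite !inE sm.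
rewrite (big_setD1 m mK) /= below_m [in RHS](big_setD1 m mK) /=.
rewrite (eq_bigr (fun s => f (a + \sum_(s' in K :\ m | key s' < key s) u s' + u s)
    - f (a + \sum_(s' in K :\ m | key s' < key s) u s'))); last first.
  move=> s sK; have -> // : \sum_(s' in K | key s' < key s) u s' =
      \sum_(s' in K :\ m | key s' < key s) u s'.
  apply: eq_bigl => s'; rewrite !inE; case: (eqVneq s' m) => [->|//] /=.
  by rewrite ltNge ltW ?andbF // lem.
rewrite IHp; last 2 first.
- by rewrite (cardsD1 m) mK in leK.
- by move=> x y; rewrite !inE => /andP[_ xK] /andP[_ yK]; exact: injK.
by rewrite [u m + _]addrC addrA addrA subrK.
Qed.

Section Sweep.
Variables (R : realFieldType) (A : zmodType) (S J : finType).
Variables (l r : S -> R * R) (u : S -> A) (p : J -> R * R) (w : J -> A).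

Definition slope (a b : R * R) : R := (b.2 - a.2) / (b.1 - a.1).
Definition height (a b : R * R) (t : R) : R := a.2 + (t - a.1) * slope a b.

Local Notation ht s := (height (l s) (r s)).
Local Notation sl s := (slope (l s) (r s)).

(* Flow enters the system of segments only at the points p j, in the amounts  *)
(* w j, and no segment passes above these points.                             *)
Hypothesis l_lt_r : forall s, (l s).1 < (r s).1.
Hypothesis noncrossing : forall s s' t, s != s' ->
  (l s).1 <= t <= (r s).1 -> (l s').1 <= t <= (r s').1 -> ht s t = ht s' t ->
  t = (l s).1 \/ t = (r s).1.
Hypothesis balance : forall P : pred (R * R),
  \sum_(s | P (l s)) u s - \sum_(s | P (r s)) u s = \sum_(j | P (p j)) w j.
Hypothesis p_top : forall j s,
  (l s).1 <= (p j).1 <= (r s).1 -> ht s (p j).1 <= (p j).2.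

Lemma height_l s : ht s (l s).1 = (l s).2.
Proof. by rewrite /height subrr mul0r addr0. Qed.

Lemma height_r s : ht s (r s).1 = (r s).2.
Proof.
rewrite /height /slope mulrC divfK; first by rewrite addrC subrK.
by rewrite subr_eq0 gt_eqF.
Qed.

Lemma height_shift s t t' : ht s t = ht s t' + (t - t') * sl s.
Proof. by rewrite /height; ring. Qed.

Definition overlap s s' := ((l s').1 < (r s).1) && ((l s).1 < (r s').1).

(** For overlapping segments this abscissa is strictly inside both, so [noncrossing] separates the
    heights there even when the segments share an end. *)
Definition mid_overlap s s' : R :=
  (Num.max (l s).1 (l s').1 + Num.min (r s).1 (r s').1) / 2.

Definition under s' s : bool :=
  ht s' (mid_overlap s s') < ht s (mid_overlap s s').

Lemma under_irr s : under s s = false.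
Proof. exact: ltxx. Qed.

Lemma mid_overlapP s s' : overlap s s' ->
  ((l s).1 < mid_overlap s s' < (r s).1) /\
  ((l s').1 < mid_overlap s s' < (r s').1).
Proof.
move=> /andP[h1 h2]; have h3 := l_lt_r s; have h4 := l_lt_r s'.
rewrite /mid_overlap; case: (leP (l s).1 (l s').1) => h5;
  case: (leP (r s).1 (r s').1) => h6;
  by split; apply/andP; split; lra.
Qed.

Lemma height_mid_neq s s' : s != s' -> overlap s s' ->
  ht s (mid_overlap s s') != ht s' (mid_overlap s s').
Proof.
move=> ss' /mid_overlapP[m1 m2]; apply/eqP => /(noncrossing ss').
by case; lra.
Qed.

(** The difference of heights is affine: a change of sign between [t] and the interior abscissa
    [mid_overlap] would produce a crossing inside [s]. *)
Lemma lt_under s s' t : s != s' -> overlap s s' ->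
  (l s).1 <= t <= (r s).1 -> (l s').1 <= t <= (r s').1 ->
  ht s' t < ht s t -> under s' s.
Proof.
move=> ss' ov t1 t2 lt_t; have [m1 m2] := mid_overlapP ov; rewrite /under.
move: (mid_overlap s s') m1 m2 (height_mid_neq ss' ov) => t0 m1 m2 neq.
rewrite ltNge; apply/negP => le0.
pose g x := ht s x - ht s' x.
have g0 : g t0 < 0 by rewrite /g subr_lt0 lt_neqAle neq.
have gt : 0 < g t by rewrite /g subr_gt0.
pose k := sl s - sl s'.
have gE x : g x = g t0 + (x - t0) * k.
  by rewrite /g /k (height_shift s x t0) (height_shift s' x t0); ring.
have k_neq0 : g t - g t0 != 0 by rewrite gt_eqF //; lra.
(* The zero of [g], in the affine coordinate that is 0 at [t0] and 1 at [t]. *)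
pose th := - g t0 / (g t - g t0).
have th01 : 0 < th < 1.
  rewrite /th divr_gt0 ?oppr_gt0 //=; last lra.
  by rewrite ltr_pdivrMr; lra.
pose z := t0 + th * (t - t0).
have gz : g z = 0.
  rewrite gE /z [t0 + _]addrC addrK -mulrA.
  have -> : (t - t0) * k = g t - g t0 by rewrite (gE t) [_ + _ * _]addrC addrK.
  by rewrite /th divfK // subrr.
have zz : (t0 < z < t) \/ (t < z < t0) \/ z = t0.
  rewrite /z; case: (ltrgtP t0 t) => h; [left | right; left | right; right].
  - by apply/andP; split; nra.
  - by apply/andP; split; nra.
  - by rewrite h subrr mulr0 addr0.
have /(noncrossing ss') : ht s z = ht s' z by move/eqP: gz; rewrite /g subr_eq0 => /eqP.
by case; lra.
Qed.

Lemma overlapC s s' : overlap s s' = overlap s' s.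
Proof. by rewrite /overlap andbC. Qed.

Lemma mid_overlapC s s' : mid_overlap s s' = mid_overlap s' s.
Proof. by rewrite /mid_overlap maxC minC. Qed.

Lemma under_le s s' t : s != s' -> overlap s s' ->
  (l s).1 <= t <= (r s).1 -> (l s').1 <= t <= (r s').1 ->
  under s' s -> ht s' t <= ht s t.
Proof.
move=> ss' ov t1 t2; rewrite /under => lt1; rewrite leNgt; apply/negP => lt2.
have := lt_under (s := s') (s' := s) (t := t).
rewrite /under eq_sym overlapC mid_overlapC => /(_ ss' ov t2 t1 lt2) /(lt_trans lt1).
by rewrite ltxx.
Qed.

(** From a common left end the heights spread in proportion to the slopes. At a common right end
    ([under_r]) the order is reversed, hence the opposite slopes used as keys there. *)
Lemma under_l s s' : l s' = l s -> under s' s = (sl s' < sl s).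
Proof.
move=> ll; have [-> |ss'] := eqVneq s' s; first by rewrite under_irr ltxx.
have ov : overlap s s' by rewrite /overlap ll l_lt_r -ll l_lt_r.
have [m1 m2] := mid_overlapP ov; rewrite /under.
rewrite (height_shift s' _ (l s).1) (height_shift s _ (l s).1).
by rewrite -{1}ll !height_l ll ltrD2l ltr_pM2l // subr_gt0; case/andP: m1.
Qed.

Lemma under_r s s' : r s' = r s -> under s' s = (- sl s' < - sl s).
Proof.
move=> rr; have [-> |ss'] := eqVneq s' s; first by rewrite under_irr ltxx.
have ov : overlap s s' by rewrite /overlap rr l_lt_r -rr l_lt_r.
have [m1 m2] := mid_overlapP ov; rewrite /under.
rewrite (height_shift s' _ (r s).1) (height_shift s _ (r s).1).
rewrite -{1}rr !height_r rr ltrD2l -[X in X < _]mulrNN -[X in _ < X]mulrNN.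
by rewrite ltr_pM2l // oppr_gt0 subr_lt0; case/andP: m1.
Qed.

Lemma slope_inj_l z : {in [set s | l s == z] &, injective (fun s => sl s)}.
Proof.
move=> s s'; rewrite !inE => /eqP lz /eqP lz' eq_sl.
have [//|ss'] := eqVneq s s'.
have ov : overlap s s' by rewrite /overlap lz' -{1}lz l_lt_r lz -lz' l_lt_r.
have /eqP[] := height_mid_neq ss' ov.
by rewrite /height eq_sl lz lz'.
Qed.

Lemma slope_inj_r z : {in [set s | r s == z] &, injective (fun s => - sl s)}.
Proof.
move=> s s'; rewrite !inE => /eqP lz /eqP lz' /oppr_inj eq_sl.
have [//|ss'] := eqVneq s s'.
have ov : overlap s s' by rewrite /overlap lz -{1}lz' l_lt_r lz' -lz l_lt_r.
have /eqP[] := height_mid_neq ss' ov.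
rewrite (height_shift s' _ (r s').1) (height_shift s _ (r s).1).
by rewrite !height_r eq_sl lz lz'.
Qed.

(* The value of the face just below s, read off near the left end of s. *)
Definition below s : A :=
  \sum_(s' | ((l s').1 <= (l s).1 < (r s').1) && under s' s) u s'.

Definition above s : A := below s + u s.

(* The flow u is conserved in the region of the strip below s, which contains *)
(* no point p j, so below may as well be read off near the right end of s.    *)
Lemma below_r s :
  below s = \sum_(s' | ((l s').1 < (r s).1 <= (r s').1) && under s' s) u s'.
Proof.
pose P (z : R * R) := ((l s).1 < z.1 < (r s).1) && (z.2 < ht s z.1).
have bal : \sum_(s' | P (l s')) u s' = \sum_(s' | P (r s')) u s'.
  apply/eqP; rewrite -subr_eq0 balance big1 // => j /andP[pj lt_pj].
  have : ht s (p j).1 <= (p j).2 by apply: p_top; lra.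
  by rewrite leNgt lt_pj.
(* The segments overlapping [s] from below split into those present at its left end, which give
   [below s], and those starting in the open region [P]; symmetrically at the right end. By
   [balance], what starts in [P] equals what ends there. *)
pose T := \sum_(s' | overlap s s' && under s' s) u s'.
have TL : T = below s + \sum_(s' | P (l s')) u s'.
  rewrite /T (bigID (fun s' => (l s').1 <= (l s).1)) /=; congr (_ + _).
    apply: eq_bigl => s'; rewrite /overlap -!andbA [under _ _ && _]andbC !andbA.
    congr (_ && _); have := l_lt_r s; have := l_lt_r s'; lra.
  apply: eq_bigl => s'; have [->|ss'] := eqVneq s' s.
    by rewrite under_irr andbF /P ltxx.
  rewrite eq_sym in ss'; have h1 := l_lt_r s'; have h2 := l_lt_r s.
  rewrite -ltNge -andbA andbCA; rewrite /P; apply/idP/idP.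
    move=> /and3P[un ov lt1]; have /andP[o1 o2] := ov; rewrite lt1 o1 /=.
    have := under_le ss' ov (t := (l s').1) _ _ un; rewrite height_l.
    move=> /(_ ltac:(lra) ltac:(lra)); rewrite le_eqVlt => /orP[/eqP|//].
    rewrite -{1}height_l => /esym /(noncrossing ss').
    by case; lra.
  move=> /andP[/andP[lt1 lt2] lt3].
  have ov : overlap s s' by rewrite /overlap; lra.
  rewrite ov lt1 /= andbT; apply: (lt_under ss' ov (t := (l s').1)); try lra.
  by rewrite height_l.
have TR : T = \sum_(s' | ((l s').1 < (r s).1 <= (r s').1) && under s' s) u s'
              + \sum_(s' | P (r s')) u s'.
  rewrite /T (bigID (fun s' => (r s).1 <= (r s').1)) /=; congr (_ + _).
    apply: eq_bigl => s'; rewrite /overlap -!andbA [under _ _ && _]andbC !andbA.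
    congr (_ && _); have := l_lt_r s; have := l_lt_r s'; lra.
  apply: eq_bigl => s'; have [->|ss'] := eqVneq s' s.
    by rewrite under_irr andbF /P ltxx andbF.
  rewrite eq_sym in ss'; have h1 := l_lt_r s'; have h2 := l_lt_r s.
  rewrite -ltNge -andbA andbCA; rewrite /P; apply/idP/idP.
    move=> /and3P[un ov lt1]; have /andP[o1 o2] := ov; rewrite lt1 o2 /=.
    have := under_le ss' ov (t := (r s').1) _ _ un; rewrite height_r.
    move=> /(_ ltac:(lra) ltac:(lra)); rewrite le_eqVlt => /orP[/eqP|//].
    rewrite -{1}height_r => /esym /(noncrossing ss').
    by case; lra.
  move=> /andP[/andP[lt1 lt2] lt3].
  have ov : overlap s s' by rewrite /overlap; lra.
  rewrite ov lt2 /= andbT; apply: (lt_under ss' ov (t := (r s').1)); try lra.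
  by rewrite height_r.
by apply: (addIr (\sum_(s' | P (l s')) u s')); rewrite -TL bal.
Qed.

(** The flow just to the right of [z] that passes below [z], from which the fan of segments starting
    at [z] is counted. Segments starting on the vertical through [z] are included, those ending on
    it are not; [left_below] is the mirror image. *)
Definition right_below (z : R * R) : A :=
  \sum_(s | ((l s).1 <= z.1 < (r s).1) && (ht s z.1 < z.2)) u s.
Definition left_below (z : R * R) : A :=
  \sum_(s | ((l s).1 < z.1 <= (r s).1) && (ht s z.1 < z.2)) u s.

Definition is_end (z : R * R) : Prop := exists s, l s = z \/ r s = z.

(** A segment with [z] in its interior would cross, at [z], the segment that ends there. *)
Lemma through_end z s : is_end z -> (l s).1 <= z.1 <= (r s).1 ->
  ht s z.1 = z.2 -> l s = z \/ r s = z.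
Proof.
move=> [s0 s0z] zs hz; have [<-//|ss0] := eqVneq s0 s.
have h0 := l_lt_r s0.
have : z.1 = (l s).1 \/ z.1 = (r s).1.
  apply: (@noncrossing s s0); rewrite // 1?eq_sym //.
    by case: s0z => <-; lra.
  by rewrite hz; case: s0z => <-; rewrite ?height_l ?height_r.
case=> ez; [left|right]; rewrite [z]surjective_pairing -hz ez.
  by rewrite height_l -surjective_pairing.
by rewrite height_r -surjective_pairing.
Qed.

(** What lies under [s] near its left end either passes below that point or belongs to the same fan
    with a smaller slope. *)
Lemma below_at_l s :
  below s = right_below (l s) + \sum_(s' | (l s' == l s) && (sl s' < sl s)) u s'.
Proof.
rewrite /below (bigID (fun s' => l s' == l s)) /= addrC; congr (_ + _).
  apply: eq_bigl => s'; have [ll|ll] := eqVneq (l s') (l s); rewrite ?andbF ?andbT /=.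
    by rewrite -ll height_l ltxx andbF.
  have [al|//] := boolP ((l s').1 <= (l s).1 < (r s').1); rewrite /=.
  have ss' : s != s' by apply: contra_neq ll => ->.
  have h1 := l_lt_r s; have ov : overlap s s' by rewrite /overlap; lra.
  apply/idP/idP => [un|lt]; last first.
    by apply: (lt_under ss' ov (t := (l s).1)); rewrite ?height_l //; lra.
  have := under_le ss' ov (t := (l s).1) _ _ un; rewrite height_l.
  move=> /(_ ltac:(lra) ltac:(lra)); rewrite le_eqVlt => /orP[/eqP hz|//].
  have [||llE|rl] := @through_end (l s) s' _ _ hz.
  - by exists s; left.
  - lra.
  - by rewrite llE eqxx in ll.
  - by rewrite rl ltxx andbF in al.
apply: eq_bigl => s'; have [ll|//] := eqVneq (l s') (l s); rewrite ?andbF //.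
by rewrite under_l // -ll lexx l_lt_r /= andbT.
Qed.

Lemma below_at_r s :
  below s = left_below (r s)
            + \sum_(s' | (r s' == r s) && (- sl s' < - sl s)) u s'.
Proof.
rewrite below_r (bigID (fun s' => r s' == r s)) /= addrC; congr (_ + _).
  apply: eq_bigl => s'; have [ll|ll] := eqVneq (r s') (r s); rewrite ?andbF ?andbT /=.
    by rewrite -ll height_r ltxx andbF.
  have [al|//] := boolP ((l s').1 < (r s).1 <= (r s').1); rewrite /=.
  have ss' : s != s' by apply: contra_neq ll => ->.
  have h1 := l_lt_r s; have ov : overlap s s' by rewrite /overlap; lra.
  apply/idP/idP => [un|lt]; last first.
    by apply: (lt_under ss' ov (t := (r s).1)); rewrite ?height_r //; lra.
  have := under_le ss' ov (t := (r s).1) _ _ un; rewrite height_r.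
  move=> /(_ ltac:(lra) ltac:(lra)); rewrite le_eqVlt => /orP[/eqP hz|//].
  have [||lr|rrE] := @through_end (r s) s' _ _ hz.
  - by exists s; right.
  - lra.
  - by rewrite lr ltxx in al.
  - by rewrite rrE eqxx in ll.
apply: eq_bigl => s'; have [ll|//] := eqVneq (r s') (r s); rewrite ?andbF //.
by rewrite under_r // -ll lexx l_lt_r /= andbT.
Qed.

Lemma sum_jump_l (f : A -> int) z :
  \sum_(s | l s == z) (f (above s) - f (below s))
  = f (right_below z + \sum_(s | l s == z) u s) - f (right_below z).
Proof.
have := telescope_by_key u f (right_below z) (@slope_inj_l z).
rewrite big_set [in RHS]big_set => <-; apply: eq_bigr => s /eqP lz.
rewrite /above below_at_l lz.
have inK k : \sum_(s' | (l s' == z) && (sl s' < k)) u s' =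
  \sum_(s' in [set s | l s == z] | sl s' < k) u s'.
  by apply: eq_bigl => s'; rewrite inE.
by rewrite inK.
Qed.

Lemma sum_jump_r (f : A -> int) z :
  \sum_(s | r s == z) (f (above s) - f (below s))
  = f (left_below z + \sum_(s | r s == z) u s) - f (left_below z).
Proof.
have := telescope_by_key u f (left_below z) (@slope_inj_r z).
rewrite big_set [in RHS]big_set => <-; apply: eq_bigr => s /eqP lz.
rewrite /above below_at_r lz.
have inK k : \sum_(s' | (r s' == z) && (- sl s' < k)) u s' =
  \sum_(s' in [set s | r s == z] | - sl s' < k) u s'.
  by apply: eq_bigl => s'; rewrite inE.
by rewrite inK.
Qed.

(** Conservation on the open vertical ray below [z], which contains no [p j]: by [p_top], a [p j] on
    that vertical is at least as high as [z]. *)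
Lemma right_left_below z : is_end z -> right_below z = left_below z.
Proof.
move=> ez; pose P (z' : R * R) := (z'.1 == z.1) && (z'.2 < z.2).
have bal : \sum_(s | P (l s)) u s = \sum_(s | P (r s)) u s.
  apply/eqP; rewrite -subr_eq0 balance big1 // => j /andP[/eqP pj1 pj2].
  case: ez => s sz; have := l_lt_r s => lr.
  have : ht s (p j).1 <= (p j).2 by apply: p_top; rewrite pj1; case: sz => <-; lra.
  rewrite leNgt => /negP[]; rewrite pj1 (lt_le_trans pj2) //.
  by case: sz => <-; rewrite ?height_l ?height_r.
rewrite /right_below (bigID (fun s => (l s).1 == z.1)) /=.
rewrite /left_below [in RHS](bigID (fun s => (r s).1 == z.1)) /=.
congr (_ + _).
  rewrite (eq_bigl (fun s => P (l s))) => [|s]; last first.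
    rewrite /P; case: (eqVneq (l s).1 z.1) => [e|_]; rewrite ?andbF //= -e.
    by rewrite lexx l_lt_r height_l andbT.
  rewrite bal; apply: eq_bigl => s.
  rewrite /P; case: (eqVneq (r s).1 z.1) => [e|_]; rewrite ?andbF //= -e.
  by rewrite lexx l_lt_r height_r andbT.
apply: eq_bigl => s; lra.
Qed.

(** The fans on both sides of [z] climb from the same value to the same value, so their telescoped
    sums agree. *)
Lemma vertex_law (f : A -> int) z : is_end z -> (forall j, p j <> z) ->
  \sum_(s | l s == z) (f (above s) - f (below s))
  = \sum_(s | r s == z) (f (above s) - f (below s)).
Proof.
move=> ez nz; rewrite sum_jump_l sum_jump_r right_left_below //.
suff -> : \sum_(s | l s == z) u s = \sum_(s | r s == z) u s by [].
apply/eqP; rewrite -subr_eq0 (balance (fun x => x == z)) big1 // => j /eqP pj.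
by case: (nz j).
Qed.

(** Balance over the half-plane to the left of [t]: the segments leaving it carry all the flow that
    entered there. *)
Lemma sum_alive_left t :
  \sum_(s | (l s).1 < t <= (r s).1) u s = \sum_(j | (p j).1 < t) w j.
Proof.
rewrite -(balance (fun x => x.1 < t)); apply/eqP; rewrite eq_sym subr_eq.
rewrite (bigID (fun s => (r s).1 < t)) /= addrC; apply/eqP; congr (_ + _).
  by apply: eq_bigl => s; rewrite -leNgt.
apply: eq_bigl => s; apply/andP/idP => [[]//|rt]; split=> //.
exact: lt_trans (l_lt_r s) rt.
Qed.

Lemma sum_alive_right t :
  \sum_(s | (l s).1 <= t < (r s).1) u s = \sum_(j | (p j).1 <= t) w j.
Proof.
rewrite -(balance (fun x => x.1 <= t)); apply/eqP; rewrite eq_sym subr_eq.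
rewrite (bigID (fun s => (r s).1 <= t)) /= addrC; apply/eqP; congr (_ + _).
  by apply: eq_bigl => s; rewrite -ltNge.
apply: eq_bigl => s; apply/andP/idP => [[]//|rt]; split=> //.
exact: le_trans (ltW (l_lt_r s)) rt.
Qed.

(** No segment passes above [p j], so each fan climbs to the total flow over the adjacent abscissas;
    the values at the bottom of the two fans cancel by [right_left_below]. *)
Lemma top_law (f : A -> int) j : is_end (p j) ->
  \sum_(s | l s == p j) (f (above s) - f (below s))
  - \sum_(s | r s == p j) (f (above s) - f (below s))
  = f (\sum_(j' | (p j').1 <= (p j).1) w j')
    - f (\sum_(j' | (p j').1 < (p j).1) w j').
Proof.
move=> ez; rewrite sum_jump_l sum_jump_r right_left_below //.
have top_r : left_below (p j) + \sum_(s | r s == p j) u s =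
             \sum_(j' | (p j').1 < (p j).1) w j'.
  rewrite -sum_alive_left /left_below.
  rewrite [in RHS](bigID (fun s => ht s (p j).1 < (p j).2)) /=; congr (_ + _).
  apply: eq_bigl => s; rewrite -leNgt.
  apply/eqP/idP => [e|/andP[al le]].
    by rewrite -e l_lt_r lexx height_r lexx.
  have /andP[al1 al2] := al.
  have [|||//] := @through_end (p j) s ez.
  - by rewrite ltW.
  - by apply/eqP; rewrite eq_le le p_top // ltW.
  - by move=> e; rewrite e ltxx in al.
have top_l : left_below (p j) + \sum_(s | l s == p j) u s =
             \sum_(j' | (p j').1 <= (p j).1) w j'.
  rewrite -right_left_below // -sum_alive_right /right_below.
  rewrite [in RHS](bigID (fun s => ht s (p j).1 < (p j).2)) /=; congr (_ + _).
  apply: eq_bigl => s; rewrite -leNgt.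
  apply/eqP/idP => [e|/andP[al le]].
    by rewrite -e l_lt_r lexx height_l lexx.
  have /andP[al1 al2] := al.
  have [|||e] := @through_end (p j) s ez.
  - by rewrite al1 ltW.
  - by apply/eqP; rewrite eq_le le p_top // al1 ltW.
  - by [].
  - by rewrite e ltxx andbF in al.
by rewrite top_l top_r opprB addrA subrK.
Qed.

End Sweep.

(** * Segments with an arbitrary direction *)

Definition segment_pt (R : realFieldType) (a b : R * R) (t : R) : R * R :=
  ((1 - t) * a.1 + t * b.1, (1 - t) * a.2 + t * b.2).

Lemma height_sym (R : realFieldType) (a b : R * R) t :
  a.1 != b.1 -> height a b t = height b a t.
Proof.
move=> ab; rewrite /height /slope.
have h1 : a.1 - b.1 != 0 by rewrite subr_eq0.
have h2 : b.1 - a.1 != 0 by rewrite subr_eq0 eq_sym.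
by field; rewrite h1 h2.
Qed.

Lemma height_segment_pt (R : realFieldType) (a b : R * R) t : a.1 != b.1 ->
  segment_pt a b ((t - a.1) / (b.1 - a.1)) = (t, height a b t).
Proof.
move=> ab; have h2 : b.1 - a.1 != 0 by rewrite subr_eq0 eq_sym.
by rewrite /segment_pt /height /slope; congr (_, _); field.
Qed.

Section DirectedSegments.
Variables (R : realFieldType) (A : zmodType) (S J : finType).
Variables (a b : S -> R * R) (ell : S -> A) (p : J -> R * R) (w : J -> A).
Hypothesis nonvertical : forall s, (a s).1 != (b s).1.
Hypothesis noncrossing : forall s s' t t', s != s' ->
  0 <= t <= 1 -> 0 <= t' <= 1 ->
  segment_pt (a s) (b s) t = segment_pt (a s') (b s') t' -> t = 0 \/ t = 1.
Hypothesis balance : forall P : pred (R * R),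
  \sum_(s | P (b s)) ell s - \sum_(s | P (a s)) ell s = \sum_(j | P (p j)) w j.
Hypothesis p_top : forall j s t, 0 <= t <= 1 ->
  (segment_pt (a s) (b s) t).1 = (p j).1 ->
  (segment_pt (a s) (b s) t).2 <= (p j).2.

Let dir s := (a s).1 < (b s).1.
Let l s := if dir s then a s else b s.
Let r s := if dir s then b s else a s.
(** Going up across a segment directed to the right leads from its right side to its left side,
    hence the minus sign. *)
Let u s := if dir s then - ell s else ell s.

Let l_lt_r s : (l s).1 < (r s).1.
Proof.
by rewrite /l /r /dir; case: (ltP (a s).1) => // ba; rewrite lt_neqAle eq_sym nonvertical.
Qed.

Let height_lr s t : height (l s) (r s) t = height (a s) (b s) t.
Proof. by rewrite /l /r; case: ifP => // _; rewrite height_sym // eq_sym. Qed.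

Let seg_time s t : (l s).1 <= t <= (r s).1 ->
  0 <= (t - (a s).1) / ((b s).1 - (a s).1) <= 1.
Proof.
rewrite /l /r /dir; case: (ltP (a s).1) => h /andP[h1 h2]; apply/andP; split.
- by apply: divr_ge0; rewrite subr_ge0 // ltW.
- by rewrite ler_pdivrMr ?subr_gt0 // mul1r lerD2r.
- by rewrite -mulrNN -invrN !opprB; apply: divr_ge0; rewrite subr_ge0.
- have {}h : (b s).1 < (a s).1 by rewrite lt_neqAle h eq_sym nonvertical.
  by rewrite -mulrNN -invrN !opprB ler_pdivrMr ?subr_gt0 // mul1r lerD2l lerN2.
Qed.

Let noncrossing_lr s s' t : s != s' ->
  (l s).1 <= t <= (r s).1 -> (l s').1 <= t <= (r s').1 ->
  height (l s) (r s) t = height (l s') (r s') t ->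
  t = (l s).1 \/ t = (r s).1.
Proof.
move=> ss' ts ts'; rewrite !height_lr => eq_h.
have [||] := noncrossing ss' (seg_time ts) (seg_time ts').
- by rewrite !height_segment_pt // eq_h.
- move/eqP; rewrite mulf_eq0 invr_eq0 !subr_eq0 [_ == (a s).1]eq_sym.
  rewrite [(b s).1 == _]eq_sym (negPf (nonvertical s)) orbF => /eqP <-.
  by rewrite /l /r; case: ifP; [left|right].
- move/(canRL (mulfVK _)); rewrite subr_eq0 eq_sym => /(_ (nonvertical s)).
  rewrite mul1r => /addIr ->.
  by rewrite /l /r; case: ifP; [right|left].
Qed.

Let sum_l_r (V : zmodType) (F : S -> V) (P : pred (R * R)) :
  \sum_(s | P (l s)) (if dir s then - F s else F s)
  - \sum_(s | P (r s)) (if dir s then - F s else F s)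
  = \sum_(s | P (b s)) F s - \sum_(s | P (a s)) F s.
Proof.
rewrite (big_mkcond (fun s => P (l s))) (big_mkcond (fun s => P (r s))).
rewrite (big_mkcond (fun s => P (b s))) (big_mkcond (fun s => P (a s))) /=.
rewrite -!sumrB; apply: eq_bigr => s _.
rewrite /l /r; case: (dir s); case: (P (a s)); case: (P (b s)) => /=;
  by rewrite ?(opprK, subr0, sub0r, addr0, add0r, subrr, addNr).
Qed.

Let balance_lr (P : pred (R * R)) :
  \sum_(s | P (l s)) u s - \sum_(s | P (r s)) u s = \sum_(j | P (p j)) w j.
Proof. by rewrite sum_l_r. Qed.

Let p_top_lr j s : (l s).1 <= (p j).1 <= (r s).1 ->
  height (l s) (r s) (p j).1 <= (p j).2.
Proof.
move=> /seg_time t01; have := p_top (j := j) (s := s) t01.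
by rewrite height_segment_pt // height_lr; apply.
Qed.

Let below_s := below l r u.
Let above_s := above l r u.

Let is_end_lr z : (exists s, a s = z \/ b s = z) -> is_end l r z.
Proof.
by case=> s sz; exists s; rewrite /l /r; case: ifP => _ //; case: sz; [right|left].
Qed.

(** [L] and [F] are the values to the left and right of a segment in its own direction; in these
    terms the two fans at a point merge into one signed sum over incoming and outgoing segments. *)
Lemma directed_segment_faces : exists L F : S -> A,
  [/\ forall s, F s = L s + ell s,
      forall (f : A -> int) z, (exists s, a s = z \/ b s = z) ->
        (forall j, p j <> z) ->
        \sum_(s | b s == z) (f (F s) - f (L s))
        - \sum_(s | a s == z) (f (F s) - f (L s)) = 0
    & forall (f : A -> int) j, (exists s, a s = p j \/ b s = p j) ->
        \sum_(s | b s == p j) (f (F s) - f (L s))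
        - \sum_(s | a s == p j) (f (F s) - f (L s))
        = f (\sum_(j' | (p j').1 <= (p j).1) w j')
          - f (\sum_(j' | (p j').1 < (p j).1) w j')].
Proof.
pose L s := if dir s then above_s s else below_s s.
pose F s := if dir s then below_s s else above_s s.
have jumpE (f : A -> int) s : f (above_s s) - f (below_s s) =
    if dir s then - (f (F s) - f (L s)) else f (F s) - f (L s).
  by rewrite /F /L; case: (dir s); rewrite // opprB.
exists L, F; split.
- move=> s; rewrite /F /L /above_s /below_s /above /u.
  by case: (dir s); rewrite ?addrK // subrK.
- move=> f z /is_end_lr ez nz; rewrite -(sum_l_r _ (fun x => x == z)).
  have := vertex_law l_lt_r noncrossing_lr balance_lr p_top_lr f ez nz.
  rewrite -/below_s -/above_s; under eq_bigr do rewrite jumpE.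
  by under [in RHS]eq_bigr do rewrite jumpE; move=> ->; rewrite subrr.
- move=> f j /is_end_lr ez; rewrite -(sum_l_r _ (fun x => x == p j)).
  rewrite -(top_law l_lt_r noncrossing_lr balance_lr p_top_lr f ez).
  by congr (_ - _); apply: eq_bigr => s _; rewrite -/below_s -/above_s jumpE.
Qed.

End DirectedSegments.

(** * Shears that leave no segment vertical *)

Definition shear (R : realFieldType) (eps : R) (z : R * R) : R * R :=
  (z.1 + eps * z.2, z.2).

Lemma shear_inj (R : realFieldType) (eps : R) : injective (shear eps).
Proof. by move=> [x y] [x' y'] /= [+ e]; rewrite e => /addIr ->. Qed.

Lemma shear_segment_pt (R : realFieldType) (eps : R) (a b : R * R) t :
  segment_pt (shear eps a) (shear eps b) t = shear eps (segment_pt a b t).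
Proof. by rewrite /segment_pt /shear /=; congr (_, _); ring. Qed.

(** A segment with ends at different heights becomes vertical only for [eps = q s], and one plus the
    sum of all absolute values exceeds every [q s]. Horizontal segments stay horizontal. *)
Lemma exists_nonvertical_shear (R : realFieldType) (S : finType)
    (a b : S -> R * R) : (forall s, a s <> b s) ->
  exists eps, forall s, (shear eps (a s)).1 != (shear eps (b s)).1.
Proof.
move=> ab; pose q s := ((b s).1 - (a s).1) / ((a s).2 - (b s).2).
exists (1 + \sum_s `|q s|) => s; apply/eqP; rewrite /shear /= => eq1.
have [eq2|neq2] := eqVneq (a s).2 (b s).2.
  apply: (ab s); rewrite [a s]surjective_pairing [b s]surjective_pairing eq2.
  by move: eq1; rewrite eq2 => /addIr ->.
have qE : q s = 1 + \sum_s `|q s|.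
  by rewrite /q; apply: (canLR (mulfK _)); [rewrite subr_eq0 | lra].
have : `|q s| <= \sum_s `|q s|.
  by rewrite (bigD1 s) //= lerDl sumr_ge0.
rewrite qE ger0_norm; first lra.
by rewrite addr_ge0 // sumr_ge0.
Qed.

(** * Faces of a web *)

Section CurveCorners.
Variable R : realType.
Implicit Types s : seq (R * R).

Lemma curve_pt0 s i : curve_pt s i 0 = nth (0, 0) s i.
Proof. by rewrite /curve_pt subr0 !mul1r !mul0r !addr0 -surjective_pairing. Qed.

Lemma curve_pt1 s i : curve_pt s i 1 = nth (0, 0) s i.+1.
Proof. by rewrite /curve_pt subrr !mul1r !mul0r !add0r -surjective_pairing. Qed.

Lemma last_ptE s : last_pt s = nth (0, 0) s (size s).-1.
Proof. by rewrite /last_pt nth_last. Qed.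

Lemma first_ptE s : first_pt s = nth (0, 0) s 0.
Proof. by rewrite /first_pt nth0. Qed.

Lemma simple_curve_corners s i : simple_curve s -> (i.+1 < size s)%N ->
  nth (0, 0) s i <> nth (0, 0) s i.+1.
Proof.
move=> simp lt_i eq_c; have [|||_] := simp i 0 i 2^-1 lt_i lt_i.
- by rewrite lexx ltr01.
- by rewrite invr_ge0 ler0n invf_lt1 ?ltr1n.
- by rewrite curve_pt0 /curve_pt -eq_c -!mulrDl subrK !mul1r -surjective_pairing.
- by move/esym/eqP; rewrite invr_eq0 pnatr_eq0.
Qed.

End CurveCorners.

Section WebCurves.
Variables (R : realType) (n m : nat) (G : web R n m).
Implicit Types (e : edge G) (i : nat) (t : R).

Local Notation corner e i := (nth (0, 0) (curve e) i).

Lemma curve_size e : (1 < size (curve e))%N.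
Proof. by have := curve_ends e; case: ends => [[? ?] [[]]|[]]. Qed.

Lemma curve_simple e : simple_curve (curve e).
Proof. by have := curve_ends e; case: ends => [[? ?] [[]]|[]]. Qed.

Lemma curve_pt_last e i t : (i.+1 < size (curve e))%N -> 0 <= t < 1 ->
  curve_pt (curve e) i t = last_pt (curve e) -> [/\ @ends _ _ _ G e = None, i = 0%N & t = 0].
Proof.
move=> lt_i t01; have := curve_ends e; case: ends => [[? ?] [[_ _ +] _ _]|].
  by move=> /(_ _ _ lt_i t01).
move=> [sz simp ->]; rewrite first_ptE -curve_pt0.
by move=> /(simp _ _ _ _ lt_i sz t01)[]; rewrite ?lexx ?ltr01.
Qed.

Lemma curve_noncrossing e i t i' t' :
  (i.+1 < size (curve e))%N -> (i'.+1 < size (curve e))%N -> i <> i' ->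
  0 <= t <= 1 -> 0 <= t' <= 1 ->
  curve_pt (curve e) i t = curve_pt (curve e) i' t' -> t = 0 \/ t = 1.
Proof.
move=> lt_i lt_i' ii' /andP[t0 t1] /andP[t'0 t'1] eq_pt.
have [->|t_neq1] := eqVneq t 1; first by right.
have {}t1 : 0 <= t < 1 by rewrite t0 lt_neqAle t_neq1.
have [t'E|t'_neq1] := eqVneq t' 1; last first.
  have {}t'1 : 0 <= t' < 1 by rewrite t'0 lt_neqAle t'_neq1.
  by have [] := curve_simple lt_i lt_i' t1 t'1 eq_pt.
(* Injectivity covers only times below 1: the end of segment [i'] is the start of the next one or
   the final point of the curve. *)
move: eq_pt; rewrite t'E curve_pt1; have [lt_S|ge_S] := ltnP i'.+2 (size (curve e)).
  rewrite -curve_pt0 => /curve_simple[]//; last by left.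
  by rewrite lexx ltr01.
have -> : i'.+1 = (size (curve e)).-1 by lia.
by rewrite -last_ptE => /curve_pt_last[]//; left.
Qed.

Lemma on_curve_end e i t b v : (i.+1 < size (curve e))%N -> 0 <= t <= 1 ->
  head_of (@ends _ _ _ G) (e, b) = Some v -> curve_pt (curve e) i t = pos v ->
  t = 1 \/ i = 0%N /\ t = 0.
Proof.
move=> lt_i /andP[t0 t1]; rewrite /head_of /=; case E: ends => [[v0 v1]|//] [] <- eq_pt.
have [->|t_neq1] := eqVneq t 1; first by left.
right; have {}t1 : 0 <= t < 1 by rewrite t0 lt_neqAle t_neq1.
have := curve_ends e; rewrite E => -[_ first last].
case: b eq_pt => eq_pt.
  by have [_ -> ->] := curve_pt_last lt_i t1 (etrans eq_pt (esym last)).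
move: eq_pt; rewrite -first first_ptE -curve_pt0 => /curve_simple[]//.
- exact: curve_size.
- by rewrite lexx ltr01.
Qed.

Lemma web_noncrossing e e' i t i' t' :
  (i.+1 < size (curve e))%N -> (i'.+1 < size (curve e'))%N ->
  (e, i) <> (e', i') -> 0 <= t <= 1 -> 0 <= t' <= 1 ->
  curve_pt (curve e) i t = curve_pt (curve e') i' t' -> t = 0 \/ t = 1.
Proof.
move=> lt_i lt_i' neq t01 t'01 eq_pt; have [ee'|ee'] := eqVneq e e'.
  rewrite -ee' in lt_i' eq_pt neq.
  by apply: curve_noncrossing lt_i lt_i' _ t01 t'01 eq_pt => ii'; rewrite ii' in neq.
have [||[b [v [hv xv]]] _] := curve_disjoint (x := curve_pt (curve e) i t) ee'.
- by exists i, t.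
- by exists i', t'; rewrite eq_pt.
by have [->|[_ ->]] := on_curve_end lt_i t01 hv xv; [right | left].
Qed.

Lemma on_curve_corner e i : (i < size (curve e))%N -> on_curve (curve e) (corner e i).
Proof.
have := curve_size e; case: i => [|i] sz lt_i.
  by exists 0%N, 0; split; rewrite ?curve_pt0 // lexx ler01.
by exists i, 1; split; rewrite ?curve_pt1 // lexx ler01.
Qed.

Lemma inner_corner_edge e e' i i' : (i.+2 < size (curve e))%N ->
  (i' < size (curve e'))%N -> corner e' i' = corner e i.+1 -> e = e'.
Proof.
move=> lt_i lt_i' eq_c; apply/eqP; apply: contraT => ee'.
have [||[b [v [hv xv]]] _] := curve_disjoint (x := corner e i.+1) ee'.
- by apply: on_curve_corner; apply: ltnW.
- by rewrite -eq_c; apply: on_curve_corner.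
move: xv; rewrite -curve_pt0 => /(on_curve_end lt_i _ hv)[].
- by rewrite lexx ler01.
- by move/eqP; rewrite eq_sym oner_eq0.
- by case.
Qed.

Lemma inner_corner_start e e' i i' : (i.+2 < size (curve e))%N ->
  (i'.+1 < size (curve e'))%N -> corner e' i' = corner e i.+1 ->
  e' = e /\ i' = i.+1.
Proof.
move=> lt_i lt_i' eq_c; have ee' := inner_corner_edge lt_i (ltnW lt_i') eq_c.
rewrite -ee' in lt_i' eq_c *; split=> //; move: eq_c; rewrite -!curve_pt0.
by move=> /curve_simple[]//; rewrite lexx ltr01.
Qed.

Lemma inner_corner_stop e e' i i' : (i.+2 < size (curve e))%N ->
  (i'.+1 < size (curve e'))%N -> corner e' i'.+1 = corner e i.+1 ->
  e' = e /\ i' = i.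
Proof.
move=> lt_i lt_i' eq_c; have ee' := inner_corner_edge lt_i lt_i' eq_c.
rewrite -ee' in lt_i' eq_c *; split=> //.
have [lt_S|ge_S] := ltnP i'.+2 (size (curve e)).
  by move: eq_c; rewrite -!curve_pt0 => /curve_simple[]//; rewrite ?lexx ?ltr01 // => -[].
move/esym: eq_c; have -> : i'.+1 = (size (curve e)).-1 by lia.
by rewrite -last_ptE -curve_pt0 => /curve_pt_last[]//; rewrite lexx ltr01.
Qed.

(** Double counting of darts, by edge and by head; a vertexless loop contributes nothing. *)
Lemma handshake (V : pzRingType) (P : pred (vert G)) (g : edge G -> V) :
  \sum_e (if @ends _ _ _ G e is Some (x, y)
          then (if P y then g e else 0) - (if P x then g e else 0) else 0)
  = \sum_(v | P v) \sum_(d : dart G | dhead d == Some v) sgn d.2 * g d.1.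
Proof.
rewrite (exchange_big_dep predT) //=.
rewrite -(pair_bigA _ (fun e b =>
  \sum_(v | P v && (dhead (e, b) == Some v)) sgn b * g e)) /=.
apply: eq_bigr => e _; rewrite big_bool /dhead /head_of /=.
case: ends => [[x y]|] /=; last first.
  by rewrite !big_pred0 ?addr0 // => v; rewrite andbF.
have sumE z (c : V) : \sum_(v | P v && (Some z == Some v)) c = if P z then c else 0.
  have someE v : (Some z == Some v) = (v == z) by rewrite eq_sym.
  case: ifP => Pz; last first.
    by apply: big_pred0 => v; rewrite someE; case: eqP => [->|]; rewrite ?Pz ?andbF.
  rewrite (big_pred1 z) // => v; rewrite someE /=.
  by case: eqP => [->|]; rewrite ?Pz ?andbF.
by rewrite !sumE mul1r mulN1r; case: (P x); rewrite ?oppr0.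
Qed.

End WebCurves.

Section WebFaces.
Variables (R : realType) (n m : nat) (G : web R n m).
Hypothesis n_gt1 : (1 < n)%N.

Lemma dhead_bdart j (d : dart G) : (dhead d == Some (inl j)) = (d == bdart G j).
Proof. exact: univalent. Qed.

Lemma Zp_vertex_sum v :
  \sum_(d : dart G | dhead d == Some v) sgn d.2 * (wt d.1)%:R
  = (if v is inl j then (bweight G j)%:R else 0 : 'Z_n).
Proof.
case: v => [j|v].
  rewrite (big_pred1 (bdart G j)) => [|d]; last exact: dhead_bdart.
  rewrite /bweight; case: (bdart G j) => e [] /=; first by rewrite mul1r.
  have /andP[_ wt_n] := wt_range e.
  by rewrite mulN1r natrB 1?ltnW // pchar_Zp // sub0r.
have /dvdzP[q sumE] := wt_balance v.
transitivity ((\sum_(d : dart G | dhead d == Some (inr v))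
    sgn d.2 * (wt d.1)%:Z)%:~R : 'Z_n).
  rewrite raddf_sum /=; apply: eq_bigr => d _.
  by rewrite intrM; case: d.2; rewrite /sgn ?rmorphN ?rmorph1.
by rewrite [X in X%:~R]sumE intrM -[n%:Z%:~R]/(n%:R) pchar_Zp // mulr0.
Qed.

Definition segment : finType := {e : edge G & 'I_(size (curve e)).-1}.

Definition seg_start (s : segment) : R * R := nth (0, 0) (curve (tag s)) (tagged s).
Definition seg_stop (s : segment) : R * R := nth (0, 0) (curve (tag s)) (tagged s).+1.

Lemma segment_lt (s : segment) : ((tagged s).+1 < size (curve (tag s)))%N.
Proof. by case: s => e i /=; have := ltn_ord i; lia. Qed.

(** Each inner corner is the stop of one segment and the start of the next, so an edge contributes
    only at its two ends and a closed loop not at all. *)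
Lemma sum_segments (V : pzRingType) (P : pred (R * R)) (g : edge G -> V) :
  \sum_(s | P (seg_stop s)) g (tag s) - \sum_(s | P (seg_start s)) g (tag s)
  = \sum_(v | P (pos v)) \sum_(d : dart G | dhead d == Some v) sgn d.2 * g d.1.
Proof.
rewrite -(handshake (fun v => P (pos v))) big_mkcond [X in _ - X]big_mkcond -sumrB /=.
pose F e i := if P (nth (0, 0) (curve e) i) then g e else 0.
transitivity (\sum_e \sum_(i < (size (curve e)).-1) (F e i.+1 - F e i)).
  exact/esym/(@sig_big_dep _ _ _ _ _ predT (fun=> predT)
    (fun e (i : 'I_(size (curve e)).-1) => F e i.+1 - F e i)).
apply: eq_bigr => e _.
rewrite -(big_mkord predT (fun i => F e i.+1 - F e i)) telescope_sumr // /F.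
rewrite -last_ptE -first_ptE; have := curve_ends e.
case: ends => [[x y] [_ -> ->]|[_ _ ->]] //; exact: subrr.
Qed.

Lemma sum_segments_weight (P : pred (R * R)) :
  \sum_(s | P (seg_stop s)) ((wt (tag s))%:R : 'Z_n)
  - \sum_(s | P (seg_start s)) (wt (tag s))%:R
  = \sum_(j : 'I_m | P (pos (inl j : vert G))) (bweight G j)%:R.
Proof.
rewrite (sum_segments P (fun e => (wt e)%:R)).
under eq_bigr do rewrite Zp_vertex_sum.
by rewrite big_sumType /= [X in _ + X]big1 ?addr0.
Qed.

Lemma corner_le0 (e : edge G) i : (nth (0, 0) (curve e) i : R * R).2 <= 0.
Proof.
have [lt_i|ge_i] := ltnP i (size (curve e)); last by rewrite nth_default.
exact/curve_half_plane/mem_nth.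
Qed.

Lemma dart_at (v : vert G) : exists d : dart G, dhead d = Some v.
Proof.
case: v => [j|v]; first by exists (bdart G j); apply/eqP; rewrite dhead_bdart.
have : (0 < #|[set d : dart G | dhead d == Some (inr v)]|)%N.
  by rewrite (trivalent v).
by case/card_gt0P => d; rewrite inE => /eqP; exists d.
Qed.

Definition seg0 (e : edge G) : segment.
Proof.
by exists e; apply: (@Ordinal _ 0); have := curve_size e; rewrite -subn1 subn_gt0.
Defined.

Lemma vertex_segment (v : vert G) : exists s : segment,
  seg_start s = pos v /\ tagged s = 0%N :> nat \/
  seg_stop s = pos v /\ (tagged s).+2 = size (curve (tag s)).
Proof.
have [[e b]] := dart_at v; rewrite /dhead /head_of /=.
have := curve_ends e; case: ends => [[x y] [_ first last]|//] /= [vE].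
have sz := curve_size e; case: b vE => <-.
  have lt_i : ((size (curve e)).-2 < (size (curve e)).-1)%N by lia.
  exists (existT _ e (Ordinal lt_i)); right; rewrite -last last_ptE /seg_stop /=.
  by split; [congr nth|]; lia.
by exists (seg0 e); left; rewrite -first first_ptE.
Qed.

(** A vertex is the first or last corner of some edge ([vertex_segment]), whereas the only segments
    starting or stopping at an inner corner are the two consecutive ones of its own edge. *)
Lemma vertex_not_inner (v : vert G) (e : edge G) i : (i.+2 < size (curve e))%N ->
  pos v <> nth (0, 0) (curve e) i.+1.
Proof.
move=> lt_i vE; have [s [[+ s0]|[+ sl]]] := vertex_segment v; rewrite vE.
  move=> /(inner_corner_start lt_i (segment_lt s)) [_]; by rewrite s0.
by move=> /(inner_corner_stop lt_i (segment_lt s)) [ee ii]; rewrite -ee -ii in lt_i; lia.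
Qed.

(** [L] and [F] label the faces to the left and right of an edge. The law holds for all [f] so that
    each color can use its own indicator function. *)
Theorem web_faces : exists L F : edge G -> 'Z_n,
  (forall e, F e = L e + (wt e)%:R) /\
  forall (f : 'Z_n -> int) v,
    \sum_(d : dart G | dhead d == Some v) sgn d.2 * (f (F d.1) - f (L d.1))
    = if v is inl j then f (\sum_(j' : 'I_m | (j' <= j)%N) (bweight G j')%:R)
                         - f (\sum_(j' : 'I_m | (j' < j)%N) (bweight G j')%:R) else 0.
Proof.
have [eps nonvertical] : exists eps, forall s : segment,
    (shear eps (seg_start s)).1 != (shear eps (seg_stop s)).1.
  apply: exists_nonvertical_shear => s.
  exact: simple_curve_corners (@curve_simple _ _ _ _ _) (segment_lt s).
pose p (j : 'I_m) := shear eps (pos (inl j : vert G)).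
(* The shear fixes the axis pointwise, so the boundary vertices keep their order. *)
have pE j : p j = (pos (inl j : vert G)).
  by rewrite /p /shear pos_axis mulr0 addr0 [RHS]surjective_pairing pos_axis.
have mono_p j j' : ((p j').1 < (p j).1) = (j' < j)%N.
  rewrite !pE; case: (ltngtP j' j) => jj'.
  - exact: pos_lr.
  - by apply/negbTE; rewrite -leNgt ltW // pos_lr.
  - by rewrite (val_inj jj') ltxx.
have [|||L [F [FE inner bdry]]] := @directed_segment_faces R 'Z_n segment 'I_m
  (shear eps \o seg_start) (shear eps \o seg_stop) (fun s => (wt (tag s))%:R)
  p (fun j => (bweight G j)%:R) nonvertical.
- move=> s s' t t' ss' t01 t'01; rewrite !shear_segment_pt => /shear_inj eq_pt.
  apply: (web_noncrossing (segment_lt s) (segment_lt s') _ t01 t'01 eq_pt).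
  case: s s' ss' {t01 t'01 eq_pt} => e i [e' i'] /= /eqP ss' [ee'].
  by subst e' => /val_inj ii'; apply: ss'; rewrite ii'.
- by move=> P; exact: (sum_segments_weight (P \o shear eps)).
- move=> j s t /andP[t0 t1] _; rewrite shear_segment_pt /= pos_axis.
  rewrite -[0]addr0 lerD // mulr_ge0_le0 ?subr_ge0 //; exact: corner_le0.
have shear_eq z z' : (shear eps z == shear eps z') = (z == z').
  exact: inj_eq (@shear_inj _ eps) _ _.
have ell0 (e : edge G) : (wt e)%:R != 0 :> 'Z_n.
  have /andP[w0 wn] := wt_range e.
  apply/eqP => /(congr1 val); rewrite /= val_Zp_nat // modn_small // => wt0.
  by rewrite wt0 in w0.
(* At an inner corner only [s'] arrives and only [s] leaves. The law for the indicator of [F s]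
   forces [F s' = F s], because [L s] differs from [F s] by a weight that is nonzero mod n. *)
have corner_const (e : edge G) i (lt_i : (i < (size (curve e)).-1)%N) :
    L (existT _ e (Ordinal lt_i)) = L (seg0 e).
  elim: i lt_i => [|i IHi] lt_i; first by congr (L (existT _ _ _)); exact: val_inj.
  have lt_i' : (i < (size (curve e)).-1)%N by exact: ltnW.
  rewrite -(IHi lt_i'); set s := existT _ _ _; set s' := existT _ _ _.
  have lt_S : (i.+2 < size (curve e))%N by lia.
  have start_s s0 : (seg_start s0 == seg_start s) = (s0 == s).
    apply/eqP/eqP => [/(inner_corner_start lt_S (segment_lt s0))|->//].
    case: s0 => e0 i0 /= [ee0]; subst e0 => ii0.
    by congr (existT _ _ _); apply: val_inj.
  have stop_s' s0 : (seg_stop s0 == seg_start s) = (s0 == s').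
    apply/eqP/eqP => [/(inner_corner_stop lt_S (segment_lt s0))|->//].
    case: s0 => e0 i0 /= [ee0]; subst e0 => ii0.
    by congr (existT _ _ _); apply: val_inj.
  have := inner (fun x => (x == F s)%:R) (shear eps (seg_start s))
    (ex_intro _ s (or_introl erefl))
    (fun j eq_p => vertex_not_inner lt_S (shear_inj eq_p)).
  rewrite (big_pred1 s') => [|s0]; last by rewrite /= shear_eq stop_s'.
  rewrite (big_pred1 s) => [|s0]; last by rewrite /= shear_eq start_s.
  have -> : (L s == F s) = false.
    by rewrite FE -[X in X == _]addr0 (inj_eq (addrI _)) eq_sym (negPf (ell0 _)).
  rewrite eqxx; case: eqP => [|_]; last by case: eqP.
  by rewrite !FE => /addIr ->.
exists (fun e => L (seg0 e)), (fun e => F (seg0 e)); split=> [e|f v].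
  by rewrite FE.
have LE s : L s = L (seg0 (tag s)) by case: s => e [i lt_i]; exact: corner_const.
have FsE s : F s = F (seg0 (tag s)) by rewrite !FE LE.
have end_v : exists s, shear eps (seg_start s) = shear eps (pos v) \/
                       shear eps (seg_stop s) = shear eps (pos v).
  by have [s sv] := vertex_segment v; exists s; case: sv => [[-> _]|[-> _]]; [left | right].
transitivity (\sum_(s | shear eps (seg_stop s) == shear eps (pos v)) (f (F s) - f (L s))
   - \sum_(s | shear eps (seg_start s) == shear eps (pos v)) (f (F s) - f (L s))).
  pose g e := f (F (seg0 e)) - f (L (seg0 e)).
  under [X in _ = X - _]eq_bigr do rewrite LE FsE -/(g _).
  under [X in _ = _ - X]eq_bigr do rewrite LE FsE -/(g _).
  rewrite (sum_segments (fun x => shear eps x == shear eps (pos v)) g).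
  rewrite (big_pred1 v) // => v'; rewrite shear_eq; exact: inj_eq (@pos_inj _ _ _ G) _ _.
case: v end_v => [j|v] end_v.
  rewrite (bdry f j end_v); congr (f _ - f _).
    by apply: eq_bigl => j'; rewrite leNgt mono_p -leqNgt.
  by apply: eq_bigl => j'; rewrite mono_p.
by apply: inner => // j /shear_inj /pos_inj.
Qed.

End WebFaces.

(** * Decomposition of flows into strands *)

Lemma mem_path_next (T : eqType) (e : rel T) x p d : path e x p ->
  d \in x :: p -> d = last x p \/ exists2 z, z \in p & e d z.
Proof.
elim: p x => [|y p IHp] x /=; first by rewrite inE => _ /eqP; left.
move=> /andP[exy pth]; rewrite inE => /orP[/eqP ->|/(IHp _ pth)].
  by right; exists y; rewrite ?mem_head.
by case=> [->|[z zp edz]]; [left | right; exists z; rewrite // inE zp orbT].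
Qed.

Lemma mem_path_prev (T : eqType) (e : rel T) x p d : path e x p ->
  d \in x :: p -> d = x \/ exists2 z, z \in belast x p & e z d.
Proof.
elim: p x => [|y p IHp] x /=; first by rewrite inE => _ /eqP; left.
move=> /andP[exy pth]; rewrite inE => /orP[/eqP ->|/(IHp _ pth)]; first by left.
case=> [->|[z zp ezd]]; right; first by exists x; rewrite ?mem_head.
by exists z; rewrite // inE zp orbT.
Qed.

Section StrandDecomposition.
Variables (R : realType) (n m : nat) (G : web R n m).
Local Notation dart := (dart G).
Implicit Types (d : dart) (D C : {set dart}).

Definition flip d : dart := (d.1, ~~ d.2).

Lemma dtail_flip d : dtail d = dhead (flip d).
Proof. by []. Qed.

Lemma flipK d : flip (flip d) = d.
Proof. by case: d => e b; rewrite /flip /= negbK. Qed.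

(** The darts followed by a conserved unit flow; such a set is a disjoint union of directed paths
    and cycles. *)
Record regular D : Prop := Regular {
  regular_flip : forall d, d \in D -> flip d \notin D;
  regular_in : forall d d' v, d \in D -> d' \in D ->
    dhead d = Some v -> dhead d' = Some v -> d = d';
  regular_out : forall d d' v, d \in D -> d' \in D ->
    dtail d = Some v -> dtail d' = Some v -> d = d';
  regular_next : forall d v, d \in D -> dhead d = Some (inr v) ->
    exists2 d', d' \in D & dtail d' = Some (inr v);
  regular_prev : forall d v, d \in D -> dtail d = Some (inr v) ->
    exists2 d', d' \in D & dhead d' = Some (inr v)
}.

(** Within [D], the set [C] is closed under passing to the next or the previous dart, so removing it
    keeps [D] regular. *)
Definition saturated D C : Prop := forall d d' v,
  dhead d = Some v -> dtail d' = Some v -> d \in D -> d' \in D ->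
  (d \in C) = (d' \in C).

Lemma regular_setD D C : regular D -> saturated D C -> regular (D :\: C).
Proof.
move=> [flipD inD outD nextD prevD] sat; split.
- by move=> d /setDP[/flipD fd _]; rewrite inE (negPf fd) andbF.
- by move=> d d' v /setDP[dD _] /setDP[d'D _]; exact: inD.
- by move=> d d' v /setDP[dD _] /setDP[d'D _]; exact: outD.
- move=> d v /setDP[dD dC] hd; have [d' d'D td'] := nextD d v dD hd.
  by exists d'; rewrite // inE d'D -(sat _ _ _ hd td' dD d'D) dC.
- move=> d v /setDP[dD dC] td; have [d' d'D hd'] := prevD d v dD td.
  by exists d'; rewrite // inE d'D (sat _ _ _ hd' td d'D dD) dC.
Qed.

Lemma regular_fst_inj D : regular D -> {in D &, injective (fun d => d.1)}.
Proof.
move=> regD [e b] [e' b'] dD d'D /= ee'; rewrite -ee' in d'D *.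
case: (eqVneq b b') => [-> //|bb'].
have := regular_flip regD dD; rewrite /flip /=.
have -> : ~~ b = b' by move: bb'; case: b {dD}; case: b' {d'D}.
by rewrite d'D.
Qed.

Lemma saturated_disjoint D C C' : regular D -> C \subset D ->
  saturated D C -> C' \subset D :\: C -> disjoint_strands C C'.
Proof.
move=> regD /subsetP CD sat /subsetP C'D; split=> [d d' dC /C'D|d d' v dC /C'D].
  move=> /setDP[d'D d'C]; apply: contraNN d'C => /eqP dd'.
  by rewrite -(regular_fst_inj regD (CD _ dC) d'D dd').
move=> /setDP[d'D]; have dD := CD _ dC; rewrite /touches => d'C.
case/orP=> /eqP hd; apply: contraNN d'C => /orP[] /eqP hd'.
- by rewrite -(regular_in regD dD d'D hd hd').
- by rewrite -(sat _ _ _ hd hd' dD d'D).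
- by rewrite (sat _ _ _ hd' hd d'D dD).
- by rewrite -(regular_out regD dD d'D hd hd').
Qed.

Lemma boundary_flip d d' (j : 'I_m) :
  dhead d = Some (inl j) -> dtail d' = Some (inl j) -> d = flip d'.
Proof.
rewrite dtail_flip => /eqP; rewrite (univalent j d) => /eqP ->.
by move/eqP; rewrite (univalent j (flip d')) => /eqP.
Qed.

Definition good_path D (s : seq dart) : bool :=
  if s is x :: p then [&& path (@consecutive _ _ _ G) x p, uniq s & all (mem D) s]
  else false.

Lemma exists_longest D d : d \in D -> exists x p, good_path D (x :: p) /\
  forall s, good_path D s -> (size s <= (size p).+1)%N.
Proof.
move=> dD; pose P k := [exists t : k.-tuple dart, good_path D t].
have P1 : exists k, P k.
  by exists 1%N; apply/existsP; exists [tuple d]; rewrite /= dD.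
have Pmax k : P k -> (k <= #|D|)%N.
  case/existsP=> -[[|x p] //= /eqP <-] /and3P[_ us sD].
  rewrite cardE; suff : {subset x :: p <= enum D} by exact: (@uniq_leq_size _ (x :: p) _ us).
  move=> y ys; rewrite mem_enum.
  by have /allP := sD : all (mem D) (x :: p); apply.
case: (ex_maxnP P1 Pmax) => k /existsP[[[|x p] //= /eqP <-] gp] maxk.
exists x, p; split=> // s gs; apply: maxk; apply/existsP.
by exists (in_tuple s).
Qed.

(** A longest path in [D] serves. If it stops at an interior vertex, the next dart can only be its
    first one, which closes a cycle; if it stops on the boundary, maximality makes it start there
    too. A vertexless loop is a strand by itself. *)
Lemma exists_strand D d : regular D -> d \in D ->
  exists C, [/\ C \subset D, C != set0, simple_strand C & saturated D C].
Proof.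
move=> regD dD.
have [/existsP[d0 /andP[d0D /eqP loop]]|noloop] :=
    boolP [exists d0 in D, dhead d0 == None].
  have tloop : dtail d0 = None.
    by move: loop; rewrite dtail_flip /dhead /head_of /=; case: ends.
  exists [set d0]; split.
  - by rewrite sub1set.
  - by apply/set0Pn; exists d0; rewrite set11.
  - exists [:: d0]; first by apply/setP => y; rewrite !inE.
    by left; rewrite /closed_path /= /consecutive loop tloop eqxx.
  - move=> d1 d2 v h1 h2 _ _; rewrite !inE.
    have [e1|_] := eqVneq d1 d0; first by rewrite e1 loop in h1.
    by have [e2|//] := eqVneq d2 d0; rewrite e2 tloop in h2.
have headS d1 : d1 \in D -> exists v, dhead d1 = Some v.
  move=> d1D; move: noloop; rewrite negb_exists => /forallP/(_ d1).
  by rewrite d1D /=; case: (dhead d1) => [v _|//]; exists v.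
have [x [p [gp maxp]]] := exists_longest dD.
have /and3P[pth us /allP sD'] := gp.
have sD y : y \in x :: p -> y \in D by exact: sD'.
have xD : x \in D by apply: sD; rewrite mem_head.
have yD : last x p \in D by apply: sD; rewrite mem_last.
have uheads : uniq [seq dhead d' | d' <- x :: p].
  rewrite map_inj_in_uniq // => d1 d2 /sD d1D /sD d2D.
  by have [v hv] := headS _ d1D; rewrite hv => /esym; exact: (regular_in regD d1D d2D hv).
have uedges : uniq [seq d'.1 | d' <- x :: p].
  by rewrite map_inj_in_uniq // => d1 d2 /sD d1D /sD; exact: (regular_fst_inj regD).
have sub : [set d' in x :: p] \subset D by apply/subsetP => y; rewrite inE; exact: sD.
have ne0 : [set d' in x :: p] != set0.
  by apply/set0Pn; exists x; rewrite inE mem_head.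
have [[j|w] hy] := headS _ yD.
  have tx : on_boundary (dtail x).
    case tx: (dtail x) => [[j'|w]|] //=; last first.
      have [v] := headS _ xD; move: tx; rewrite dtail_flip /dhead /head_of /=.
      by case: ends.
    have [z zD hz] := regular_prev regD xD tx.
    have [zs|zs] := boolP (z \in x :: p); last first.
      suff /maxp : good_path D (z :: x :: p) by rewrite /= ltnn.
      apply/and3P; split; first by rewrite /= {1}/consecutive hz tx eqxx.
        by rewrite cons_uniq zs.
      by apply/allP => y; rewrite in_cons => /orP[/eqP ->|/sD].
    have [zy|[y yp /eqP czy]] := mem_path_next pth zs.
      by rewrite zy hy in hz.
    have yx : y = x.
      by apply: (regular_out regD _ xD _ tx); [apply: sD; rewrite inE yp orbT | rewrite -czy].
    by move: us; rewrite /= -yx yp.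
  exists [set d' in x :: p]; split=> //.
    exists (x :: p) => //; right; rewrite /open_path pth tx hy uedges.
    rewrite cons_uniq uheads !andbT.
    (* A dart ending at the boundary vertex where the path starts would be the reverse of the first
       dart, which [D] excludes. *)
    case etx: (dtail x) tx => [[j'|//]|//] _.
    apply/mapP => -[z /sD zD /esym hz].
    have := regular_flip regD xD; rewrite -(boundary_flip hz etx) zD //.
  move=> d1 d2 v h1 h2 d1D d2D; rewrite 2!in_set.
  apply/idP/idP => [s1|s2].
    have [e1|[z zp /eqP c1z]] := mem_path_next pth s1.
      move: h1 h2; rewrite e1 hy => -[<-] /(boundary_flip hy) ye.
      by have := regular_flip regD d2D; rewrite -ye yD.
    suff <- : z = d2 by rewrite inE zp orbT.
    apply: (regular_out regD _ d2D _ h2); last by rewrite -c1z.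
    by apply: sD; rewrite inE zp orbT.
  have [e2|[z zp /eqP cz2]] := mem_path_prev pth s2.
    case etx: (dtail x) tx => [[j'|//]|//] _.
    move: h2 h1; rewrite e2 etx => -[<-] h1.
    by have := regular_flip regD xD; rewrite -(boundary_flip h1 etx) d1D.
  have zs := mem_belast zp.
  suff <- : z = d1 by [].
  by apply: (regular_in regD (sD _ zs) d1D _ h1); rewrite cz2.
have [z zD tz] := regular_next regD yD hy.
have zs : z \in x :: p.
  apply: contraT => zs.
  suff /maxp : good_path D (rcons (x :: p) z) by rewrite size_rcons ltnn.
  apply/and3P; split.
  - by rewrite rcons_path pth /= /consecutive hy tz.
  - by rewrite rcons_uniq zs.
  - by apply/allP => y; rewrite mem_rcons in_cons => /orP[/eqP ->|/sD].
have zx : z = x.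
  have [//|[y yp /eqP cyz]] := mem_path_prev pth zs.
  have ey : y = last x p.
    by apply: (regular_in regD _ yD _ hy); [apply: sD; exact: mem_belast | rewrite cyz].
  by move: us; rewrite lastI rcons_uniq -ey yp.
have cyc : cycle (@consecutive _ _ _ G) (x :: p).
  by rewrite /= rcons_path pth /consecutive hy -zx tz /=.
exists [set d' in x :: p]; split=> //.
  by exists (x :: p) => //; left; rewrite /closed_path cyc uheads uedges.
move=> d1 d2 v h1 h2 d1D d2D; rewrite 2!in_set; apply/idP/idP => [s1|s2].
  have /eqP c := next_cycle cyc s1; have ns := s1; rewrite -mem_next in ns.
  suff <- : next (x :: p) d1 = d2 by [].
  by apply: (regular_out regD (sD _ ns) d2D _ h2); rewrite -c.
have /eqP c := prev_cycle cyc s2; have ns := s2; rewrite -mem_prev in ns.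
suff <- : prev (x :: p) d2 = d1 by [].
by apply: (regular_in regD (sD _ ns) d1D _ h1); rewrite c.
Qed.

Lemma disjoint_strandsC C C' : disjoint_strands C C' -> disjoint_strands C' C.
Proof.
move=> [h1 h2]; split=> [d d' dC d'C|d d' v dC d'C tv]; first by rewrite eq_sym h1.
by apply: contraL tv => tv'; exact: h2 tv'.
Qed.

Lemma strand_decomposition D : regular D -> exists Q : {set {set dart}},
  [/\ forall C, C \in Q -> simple_strand C,
      forall C C', C \in Q -> C' \in Q -> C != C' -> disjoint_strands C C'
    & cover Q = D].
Proof.
have [k] := ubnP #|D|; elim: k D => // k IHk D leD regD.
have [->|[d dD]] := set_0Vmem D.
  by exists set0; split=> [C|C C'|]; rewrite ?inE // /cover big_set0.
have [C [CD C0 strC sat]] := exists_strand regD dD.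
have [||Q [strQ disQ covQ]] := IHk (D :\: C); last first.
- have disC C' : C' \in Q -> disjoint_strands C C'.
    move=> C'Q; apply: (saturated_disjoint regD CD sat).
    by rewrite -covQ; exact: (bigcup_sup C').
  exists (C |: Q); split.
  + by move=> C' /setU1P[->//|]; exact: strQ.
  + move=> C1 C2 /setU1P[->|C1Q] /setU1P[->|C2Q] neq; last exact: disQ.
    * by rewrite eqxx in neq.
    * exact: disC.
    * exact/disjoint_strandsC/disC.
  + rewrite /cover bigcup_setU big_set1 -/(cover Q) covQ.
    by apply/setP => y; rewrite !inE;
      case: (boolP (y \in C)) => [/(subsetP CD) ->|].
- exact: regular_setD.
- have [y yC] := set0Pn _ C0; rewrite -ltnS; apply: (leq_ltn_trans _ leD).
  apply: proper_card; apply/properP; split; first exact: subsetDl.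
  by exists y; rewrite ?(subsetP CD) // inE yC.
Qed.

End StrandDecomposition.

(** Two values 1 would force the third to be -2. This is how trivalence keeps strands of one color
    disjoint. *)
Lemma card3_sum0_inj (T : finType) (X : {set T}) (g : T -> int) :
  #|X| = 3%N -> (forall x, -1 <= g x) -> \sum_(x in X) g x = 0 ->
  {in X &, forall x y, g x = 1 -> g y = 1 -> x = y}.
Proof.
move=> cardX g_ge sum0 x y xX yX gx gy; apply/eqP; apply: contraT => xy.
have : \sum_(z in X) (g z + 1) = 3.
  by rewrite big_split /= sum0 sumr_const cardX.
rewrite (big_setD1 x xX) (big_setD1 y) /=; last by rewrite !inE eq_sym xy.
rewrite gx gy; set s := \sum_(_ in _) _ => sumE.
have : 0 <= s by apply: sumr_ge0 => z _; have := g_ge z; lia.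
lia.
Qed.

Lemma sum0_exists_neg (T : finType) (X : {set T}) (g : T -> int) x :
  \sum_(y in X) g y = 0 -> x \in X -> 0 < g x -> exists2 y, y \in X & g y < 0.
Proof.
move=> sum0 xX gx.
have [/existsP[y /andP[yX gy]]|] := boolP [exists y in X, g y < 0]; first by exists y.
rewrite negb_exists => /forallP g_ge0; exfalso.
move: sum0; rewrite (big_setD1 x xX) /=; set s := \sum_(_ in _) _ => sumE.
have : 0 <= s.
  apply: sumr_ge0 => y /setD1P[_ yX]; have := g_ge0 y.
  by rewrite yX /= -leNgt.
lia.
Qed.

Section FlowStranding.
Variables (R : realType) (n m : nat) (G : web R n m).
Variable a : edge G -> 'I_n -> int.
Hypothesis a_range : forall e c, [|| a e c == 0, a e c == 1 | a e c == -1].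
Hypothesis a_color0 : forall e (c : 'I_n), c = 0%N :> nat -> a e c = 0.
Hypothesis conservation : forall v c,
  \sum_(d : dart G | dhead d == Some (inr v)) sgn d.2 * a d.1 c = 0.

Lemma regular_color c : regular [set d : dart G | a d.1 c == sgn d.2].
Proof.
pose X v := [set d : dart G | dhead d == Some (inr v)].
have cardX v : #|X v| = 3%N by exact: trivalent.
(* The flow through [d] into its head. Reversing a dart negates it, so outgoing darts are handled by
   applying the same lemmas to [- g]. *)
pose g (d : dart G) : int := sgn d.2 * a d.1 c.
have sum_g v : \sum_(d in X v) g d = 0.
  by rewrite -[RHS](conservation v c); apply: eq_bigl => d; rewrite inE.
have g_flip (d : dart G) : g (flip d) = - g d.
  by rewrite /g /flip /=; case: d.2; rewrite /= ?mul1r ?mulN1r ?opprK.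
have g_ge d : -1 <= g d.
  by rewrite /g; have := a_range d.1 c; case: d.2; rewrite /sgn; lia.
have g_le d : -1 <= - g d.
  by rewrite /g; have := a_range d.1 c; case: d.2; rewrite /sgn; lia.
have inD (d : dart G) : (d \in [set d : dart G | a d.1 c == sgn d.2]) = (g d == 1).
  by rewrite inE /g; case: d.2; rewrite /sgn; lia.
have sum_Ng v : \sum_(d in X v) - g d = 0 by rewrite sumrN sum_g oppr0.
have inX (d : dart G) v : dhead d = Some (inr v) -> d \in X v by rewrite inE => ->.
split.
- by move=> d; rewrite !inD g_flip; lia.
- move=> d d' [j|v]; rewrite !inD => /eqP gd /eqP gd' hd hd'.
    by move/eqP: hd; move/eqP: hd'; rewrite !dhead_bdart => /eqP -> /eqP ->.
  exact: (card3_sum0_inj (cardX v) g_ge (sum_g v) (inX _ _ hd) (inX _ _ hd') gd gd').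
- move=> d d' [j|v]; rewrite !inD !dtail_flip => /eqP gd /eqP gd' hd hd';
    rewrite -[d]flipK -[d']flipK; congr flip.
    by move/eqP: hd; move/eqP: hd'; rewrite !dhead_bdart => /eqP -> /eqP ->.
  apply: (card3_sum0_inj (cardX v) g_le (sum_Ng v) (inX _ _ hd) (inX _ _ hd')).
    by rewrite g_flip gd.
  by rewrite g_flip gd'.
- move=> d v; rewrite inD => /eqP gd hd.
  have [|d' d'X gd'] := sum0_exists_neg (sum_g v) (inX _ _ hd); first by rewrite gd.
  exists (flip d'); first by rewrite inD g_flip; have := g_ge d'; lia.
  by rewrite dtail_flip flipK; move: d'X; rewrite inE => /eqP.
- move=> d v; rewrite inD dtail_flip => /eqP gd hd.
  have [|d' d'X gd'] := sum0_exists_neg (sum_Ng v) (inX _ _ hd).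
    by rewrite g_flip gd.
  exists d'; first by rewrite inD; have := g_le d'; lia.
  by move: d'X; rewrite inE => /eqP.
Qed.

Lemma flow_stranding : exists S : {set 'I_n * {set dart G}},
  stranding S /\ forall e c, alpha S e c = a e c.
Proof.
have /fin_all_exists[Q QP] : forall c, exists Q : {set {set dart G}},
    [/\ forall C, C \in Q -> simple_strand C,
        forall C C', C \in Q -> C' \in Q -> C != C' -> disjoint_strands C C'
      & cover Q = [set d : dart G | a d.1 c == sgn d.2]].
  by move=> c; exact/strand_decomposition/regular_color.
exists [set s : 'I_n * {set dart G} | (0 < s.1)%N && (s.2 \in Q s.1)]; split.
  split=> [s|s s']; rewrite inE => /andP[s0 sQ].
    by split=> //; have [strQ _ _] := QP s.1; exact: strQ.
  rewrite inE => /andP[_ s'Q] neq eq1; have [_ disQ _] := QP s.1.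
  apply: disQ; rewrite ?eq1 // -?eq1 //; apply: contra neq => /eqP eq2.
  by rewrite [s]surjective_pairing eq1 eq2 -surjective_pairing.
move=> e c; set S := finset _.
have colE (d : dart G) : (c \in colors S d) = (0 < c)%N && (a d.1 c == sgn d.2).
  have [_ _ covQ] := QP c; have -> : (a d.1 c == sgn d.2) = (d \in cover (Q c)).
    by rewrite covQ inE.
  rewrite inE; apply/existsP/andP => [[s /and3P[]]|[c0 /bigcupP[C CQ dC]]].
    by rewrite inE => /andP[s0 sQ] /eqP <- ds; split=> //; apply/bigcupP; exists s.2.
  by exists (c, C); rewrite inE /= c0 CQ eqxx.
rewrite /alpha !colE /= /sgn; have [c0|_] := posnP c; first by rewrite a_color0.
by case/or3P: (a_range e c) => /eqP ->.
Qed.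

End FlowStranding.

(** * The base stranding *)

(* The color-c flow across an edge whose left and right faces are labelled by *)
(* the residues x and y.                                                      *)
Definition face_flow n (x y : nat) (c : 'I_n) : int :=
  if (c : nat) == 0%N then 0 else (y == c)%N%:Z - (x == c)%N%:Z.

Section FaceFlow.
Variables (n x y : nat).
Hypotheses (lt_x : (x < n)%N) (lt_y : (y < n)%N) (neq_xy : x <> y).

Local Notation a := (@face_flow n x y).

Lemma face_flow_range c : [|| a c == 0, a c == 1 | a c == -1].
Proof. by rewrite /face_flow; case: ifP => // _; case: (y == c)%N; case: (x == c)%N. Qed.

Lemma face_flow_neq0 c : (a c != 0) = (c != 0%N :> nat) && ((y == c)%N || (x == c)%N).
Proof. by rewrite /face_flow; case: (eqVneq (c : nat) 0%N) => //= _; lia. Qed.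

Lemma face_flow_label_last : label_last a = (y < x)%N.
Proof.
apply/existsP/idP => [[c /andP[/andP[_ /forallP maxc] ac]]|yx].
  have := maxc (Ordinal lt_y); rewrite face_flow_neq0 /= => le_y.
  by move: ac; rewrite /face_flow; case: (eqVneq (c : nat) 0%N) => // c0; lia.
exists (Ordinal lt_x); rewrite /is_cmax face_flow_neq0 /=; apply/andP; split.
  apply/andP; split; first by lia.
  by apply/forallP => d; rewrite face_flow_neq0; lia.
by rewrite /face_flow /=; case: (eqVneq x 0%N); lia.
Qed.

Lemma sum_pos_indicator z i : (z < n)%N ->
  \sum_(d : 'I_n | (i < d)%N) (z == d)%N%:Z = (i < z)%N%:Z :> int.
Proof.
move=> lt_z; have [iz|zi] := ltnP i z; last by apply: big1 => d; lia.
rewrite (bigD1 (Ordinal lt_z)) //= eqxx big1 ?addr0 // => d.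
by rewrite -(inj_eq val_inj) /=; lia.
Qed.

(** This is $\vec\lambda_y-\vec\lambda_x$, plus $\vec 1$ if $y<x$; as positions count from 0,
    [i < y] means that position $i+1$ is among the first $y$. *)
Lemma face_flow_label_val i :
  label_val a i = (y < x)%N%:Z + (i < y)%N%:Z - (i < x)%N%:Z.
Proof.
rewrite /label_val face_flow_label_last -addrA; congr (_ + _).
rewrite -(sum_pos_indicator _ lt_y) -(sum_pos_indicator _ lt_x) -sumrB.
by apply: eq_bigr => d id; rewrite /face_flow; case: (eqVneq (d : nat) 0%N); lia.
Qed.

Lemma sum_indicator_id z : (z < n)%N ->
  \sum_(d : 'I_n) (z == d)%N%:Z * (d : nat)%:Z = z%:Z :> int.
Proof.
move=> lt_z; rewrite (bigD1 (Ordinal lt_z)) //= eqxx mul1r big1 ?addr0 // => d.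
by rewrite -(inj_eq val_inj) /= eq_sym => /negPf ->; rewrite mul0r.
Qed.

(** Color y has sign 1 and color x sign -1, a color 0 being dropped. The larger one is the top
    color, and the sum y - x is l or l - n according to its sign. *)
Lemma face_flow_valid l : (0 < l < n)%N -> (x + l = y \/ x + l = y + n)%N ->
  valid_edge l a.
Proof.
move=> l_range xly; apply/andP; split.
  apply/forallP => c; apply/forallP => c'; apply/implyP => /and4P[cc'].
  rewrite !face_flow_neq0 => ac ac' _.
  rewrite /face_flow; case: (eqVneq (c : nat) 0%N); first by lia.
  by case: (eqVneq (c' : nat) 0%N); lia.
have lt_m : (maxn x y < n)%N by lia.
apply/existsP; exists (Ordinal lt_m); rewrite /is_cmax face_flow_neq0 /=.
apply/andP; split.
  apply/andP; split; first by lia.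
  by apply/forallP => d; rewrite face_flow_neq0; lia.
have -> : \sum_(d : 'I_n) a d * (d : nat)%:Z = y%:Z - x%:Z.
  rewrite -(sum_indicator_id lt_y) -(sum_indicator_id lt_x) -sumrB.
  apply: eq_bigr => d _; rewrite /face_flow -mulrBl.
  by case: (eqVneq (d : nat) 0%N) => // ->; rewrite !mulr0.
have -> : a (Ordinal lt_m) = (x < y)%N%:Z - (y < x)%N%:Z.
  by rewrite /face_flow /=; case: (eqVneq (maxn x y) 0%N); lia.
by case: (ltngtP x y) => //=; lia.
Qed.

End FaceFlow.

Lemma partial_residue_lt n m (k : 'I_m -> nat) j : (1 < n)%N -> (partial_residue n k j < n)%N.
Proof. by move=> n1; rewrite ltn_mod ltnW. Qed.

Lemma label_face_flow n x y (p : 'I_n) : (x < n)%N -> (y < n)%N -> x <> y ->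
  label (@face_flow n x y) p =
  ((if (x < y)%N then lambda y p - lambda x p else 1 + lambda y p - lambda x p) == 1).
Proof.
move=> lt_x lt_y xy; rewrite ffunE face_flow_label_val // /lambda.
by case: (ltngtP x y) xy => //= _ _; rewrite ?add0r.
Qed.

(** Reversing an edge exchanges its two faces, which matches the complement taken at boundary edges
    directed away from the axis. *)
Lemma compl_label_face_flow n x y (p : 'I_n) : (x < n)%N -> (y < n)%N -> x <> y ->
  compl_label (label (@face_flow n x y)) p = label (@face_flow n y x) p.
Proof.
move=> lt_x lt_y xy; rewrite ffunE !label_face_flow //; last exact/nesym.
by rewrite /lambda; case: (ltngtP x y) xy => //= ? _; lia.
Qed.

Section BaseStranding.
Variables (R : realType) (n m : nat) (n_gt1 : (1 < n)%N) (k : 'I_m -> nat).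
Variables (k_range : forall j, (0 < k j < n)%N) (G : webF R n k).

Lemma val_partial_sum (i : nat) :
  (\sum_(j : 'I_m | (j < i)%N) ((bweight G j)%:R : 'Z_n)) = partial_residue n k i :> nat.
Proof.
rewrite -natr_sum val_Zp_nat // /partial_residue; congr (_ %% _)%N.
by apply: eq_bigr => j _; exact: webF_bweight.
Qed.

Lemma partial_residueS (j : 'I_m) : partial_residue n k j.+1 <> partial_residue n k j.
Proof.
have /andP[k0 kn] := k_range j; rewrite /partial_residue.
rewrite (bigD1 j) //= (eq_bigl (fun t : 'I_m => (t < j)%N)) => [|t]; last first.
  by rewrite -(inj_eq val_inj) /=; lia.
move: (\sum_(_ < _ | _) _)%N => s eq_s.
have : k j + s = 0 + s %[mod n] by rewrite add0n.
by move/eqP; rewrite eqn_modDr mod0n modn_small // => /eqP kj; rewrite kj in k0.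
Qed.

Theorem exists_base_stranding : exists S : Str G,
  forall j, hat_label S j = base_label k_range j.
Proof.
have [L [F [FE law]]] := web_faces G n_gt1.
have lt_n (z : 'Z_n) : (z < n)%N by rewrite -[X in (_ < X)%N](Zp_cast n_gt1).
pose a e := @face_flow n (L e) (F e).
have FLE e : ((L e + wt e = F e)%N \/ (L e + wt e = F e + n)%N).
  have /andP[w0 wn] := wt_range e; have := lt_n (L e).
  have -> : (F e : nat) = ((L e + wt e) %% n)%N.
    by rewrite FE /= val_Zp_nat // [X in (_ %% X)%N = _]Zp_cast // modnDmr.
  have [lt|ge] := ltnP (L e + wt e)%N n; first by left; rewrite modn_small.
  by right; rewrite -(subnK ge) modnDr modn_small; lia.
have LneF e : (L e : nat) <> F e.
  by have := wt_range e; have := FLE e; lia.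
(* The indicator of the residue c, set to zero for c = 0, which is not a color. *)
pose f (c : 'I_n) (z : 'Z_n) : int :=
  if (c : nat) == 0%N then 0 else ((z : nat) == c)%N%:Z.
have aE e c : a e c = f c (F e) - f c (L e).
  by rewrite /a /f /face_flow; case: ifP.
have [S [strS alphaE]] : exists S : {set 'I_n * {set dart G}},
    stranding S /\ forall e c, alpha S e c = a e c.
  apply: flow_stranding => [e c|e c c0|v c].
  - exact: face_flow_range.
  - by rewrite /a /face_flow c0.
  - by rewrite -[RHS](law (f c) (inr v)); apply: eq_bigr => d _; rewrite aE.
have alphaE' e : alpha S e = a e by apply: funext => c; exact: alphaE.
have validS : valid_stranding S.
  apply/andP; split; first exact/asboolP.
  by apply/forallP => e; rewrite alphaE'; apply: face_flow_valid => //; exact: wt_range.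
exists (exist _ S validS) => j; apply: val_inj; apply/ffunP => p /=.
set c0 := partial_residue n k j; set c1 := partial_residue n k j.+1.
have lt_c0 : (c0 < n)%N by exact: partial_residue_lt.
have lt_c1 : (c1 < n)%N by exact: partial_residue_lt.
have c01 : c0 <> c1 by apply/nesym/partial_residueS.
(* By the boundary case of the law, the flow into vertex [j] is that of an edge with faces [c0] and
   [c1]. *)
have bdry c : sgn (bdart G j).2 * a (bdart G j).1 c = face_flow c0 c1 c.
  have := law (f c) (inl j).
  rewrite (big_pred1 (bdart G j)) => [|d]; last exact: dhead_bdart.
  rewrite -aE => ->; rewrite /f /face_flow (val_partial_sum j.+1) (val_partial_sum j).
  by case: ifP.
rewrite [RHS]ffunE /bdry_label alphaE'.
transitivity (label (@face_flow n c0 c1) p); last by rewrite label_face_flow.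
case: (bdart G j) bdry => e [] /= bdry.
  by congr (label _ p); apply: funext => c; rewrite -bdry mul1r.
rewrite -[in RHS]compl_label_face_flow //; last exact/nesym.
congr (compl_label (label _) p); apply: funext => c.
have -> : face_flow c1 c0 c = - face_flow c0 c1 c.
  by rewrite /face_flow; case: ifP; rewrite ?oppr0 ?opprB.
by rewrite -bdry mulN1r opprK.
Qed.

End BaseStranding.

(** * Nonvanishing by specialization at q = -1 *)

Lemma sum_Npow_qvar_neq0 (R : realType) (T : finType) (z : T -> int) (P : pred T) t :
  P t -> \sum_(s | P s) (- qvar R) ^ z s <> 0.
Proof.
(* Multiplying by $(-q)^N$ clears the negative exponents; the resulting polynomial takes at -1 the
   number of terms as its value, nonzero in characteristic 0. *)
move=> Pt sum0; pose N := (\sum_s `|z s|)%N.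
have q0 : - qvar R != 0 by rewrite oppr_eq0 tofrac_eq0 polyX_eq0.
have zN s : 0 <= z s + N%:Z.
  have : (`|z s| <= N)%N by rewrite /N (bigD1 s) //= leq_addr.
  lia.
have : \sum_(s | P s) (- 'X : {poly R[i]}) ^+ `|z s + N%:Z| = 0.
  apply/eqP; rewrite -tofrac_eq0 rmorph_sum /=; apply/eqP.
  transitivity ((\sum_(s | P s) (- qvar R) ^ z s) * (- qvar R) ^ N%:Z); last first.
    by rewrite sum0 mul0r.
  rewrite mulr_suml; apply: eq_bigr => s _.
  by rewrite -expfzDr // rmorphXn rmorphN [LHS]exprnP gez0_abs.
move/(congr1 (fun p : {poly R[i]} => p.[-1])); rewrite horner_sum horner0.
under eq_bigr do rewrite !hornerE opprK expr1n.
by rewrite sumr_const => /eqP; rewrite pnatr_eq0 => /eqP/card0_eq/(_ t); rewrite unfold_in Pt.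
Qed.

Theorem corollary57 (R : realType) (n m : nat) (hn : (2 <= n)%N)
    (k : 'I_m -> nat) (hk : forall j : 'I_m, (0 < k j < n)%N)
    (G : webF R n k) :
  web_vector G <> 0 /\ coef (base_label hk) (web_vector G) <> 0.
Proof.
have [S0 S0E] := exists_base_stranding hn hk G.
suff coef_neq0 : coef (base_label hk) (web_vector G) <> 0.
  by split=> // G0; apply: coef_neq0; rewrite G0 /coef ffunE.
pose P (S : Str G) := [forall j, base_label hk j == hat_label S j].
have -> : coef (base_label hk) (web_vector G) =
    \sum_(S | P S) (- qvar R) ^ ((xnum (val S))%:Z - (ynum (val S))%:Z).
  rewrite /coef sum_ffunE [RHS]big_mkcond; apply: eq_bigr => S _.
  rewrite ffunE /xS -/(coef _ _) coef_tensor -/(P S).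
  by case: (P S); rewrite ?[LHS]mulr1 ?[LHS]mulr0.
by apply: (sum_Npow_qvar_neq0 (t := S0)); apply/forallP => j; rewrite S0E.
Qed.
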